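(* Let $T>0$ and let $\hat G_1,\hat G_2:(0,T]\to\mathcal{M}_d(\mathbb{R})$ be measurable kernels for which there exists $\bar C>0$ such that $\|\hat G_j(t)\|^2\le \bar C(1+\|G_j(t)\|^2)$ for $j\in\{1,2\}$ and $t\in(0,T]$. For $N\in\mathbb{N}^*$ and $t_k=kT/N$, let $X^N$ and $\hat X^N$ be the Volterra Euler schemes defined by $X^N_{t_0}=\hat X^N_{t_0}=x_0$ and, for $0\le k\le N-1$, $$X^N_{t_{k+1}}=x_0+\sum_{j=0}^k G_1(t_{k+1-j})\,b(X^N_{t_j})\frac TN+\sum_{j=0}^k G_2(t_{k+1-j})\,\sigma(X^N_{t_j})(W_{t_{j+1}}-W_{t_j}),$$ $$\hat X^N_{t_{k+1}}=x_0+\sum_{j=0}^k \hat G_1(t_{k+1-j})\,b(\hat X^N_{t_j})\frac TN+\sum_{j=0}^k \hat G_2(t_{k+1-j})\,\sigma(\hat X^N_{t_j})(W_{t_{j+1}}-W_{t_j}).$$ Then there exists a constant $C>0$, not depending on $N$ (and depending on $x_0$, $T$, $b$, $\sigma$, $G_1$, $G_2$ and $\bar C$), such that for all $N\in\mathbb{N}^*$, $$\max_{0\le k\le N}\mathbb{E}[|\hat X^N_{t_k}-X^N_{t_k}|^2]\le C\,\frac TN\sum_{k=1}^N\Big(\|\hat G_1(t_k)-G_1(t_k)\|^2+\|\hat G_2(t_k)-G_2(t_k)\|^2\Big).$$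
   Context: Fix $d\ge1$, a deterministic $x_0\in\mathbb{R}^d$ and a standard $d$-dimensional Brownian motion $W$ on a filtered probability space. $\mathcal{M}_d(\mathbb{R})$ is the space of real $d\times d$ matrices, $|\cdot|$ is the Euclidean norm on $\mathbb{R}^d$ and $\|\cdot\|$ the Frobenius norm on $\mathcal{M}_d(\mathbb{R})$; $\mathbb{R}_+=[0,\infty)$. The coefficients $b:\mathbb{R}^d\to\mathbb{R}^d$ and $\sigma:\mathbb{R}^d\to\mathcal{M}_d(\mathbb{R})$ are globally Lipschitz: there is $L>0$ with $|b(x)-b(y)|+\|\sigma(x)-\sigma(y)\|\le L|x-y|$ for all $x,y$. $\lambda$ is a (nonnegative) measure on $\mathbb{R}_+$ such that $\bar G(t):=\int_{\mathbb{R}_+}e^{-\rho t}\lambda(d\rho)<\infty$ for all $t>0$ and $\int_0^{S}\bar G(t)^2dt<\infty$ for all $S>0$. $M_1,M_2:\mathbb{R}_+\to\mathcal{M}_d(\mathbb{R})$ are bounded measurable functions and $G_j(t)=\int_{\mathbb{R}_+}e^{-\rho t}M_j(\rho)\lambda(d\rho)$ for $t>0$, $j\in\{1,2\}$. *)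

(* Defs.v *)
From mathcomp Require Import all_boot all_order all_algebra.
From mathcomp Require Import all_classical all_reals all_analysis.

Set Implicit Arguments.
Unset Strict Implicit.
Unset Printing Implicit Defensive.
Import Order.TTheory GRing.Theory Num.Theory.
Import numFieldNormedType.Exports.

Local Open Scope classical_set_scope.
Local Open Scope ring_scope.

(* The library norm on matrices is the sup norm, so the Euclidean norm of
   column vectors and the Frobenius norm are defined here. *)
Definition euclid_norm (R : realType) (d : nat) (x : 'cV[R]_d) : R :=
  Num.sqrt (\sum_i x i 0 ^+ 2).

Definition frob_norm (R : realType) (d : nat) (A : 'M[R]_d) : R :=
  Num.sqrt (\sum_i \sum_j A i j ^+ 2).

Definition lipschitz_coefs (R : realType) (d : nat)
    (b : 'cV[R]_d -> 'cV[R]_d) (sigma : 'cV[R]_d -> 'M[R]_d) : Prop :=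
  exists L : R, 0 < L /\ forall x y,
    euclid_norm (b x - b y) + frob_norm (sigma x - sigma y)
      <= L * euclid_norm (x - y).

(* Entrywise measurability is measurability for the Borel sigma-algebra of
   M_d(R) = R^(d * d). *)
Definition measurable_mx (R : realType) (d : nat) (D : set R)
    (M : R -> 'M[R]_d) : Prop :=
  forall i j, measurable_fun D (fun t => M t i j).

(* A measure on R_+ is represented by a measure lambda on R of which only the
   restriction to [0, +oo[ is ever used. *)
Definition Gbar (R : realType) (lambda : {measure set (measurableTypeR R) -> \bar R}) (t : R) :
    \bar R :=
  (\int[lambda]_(rho in `[0%R, +oo[) (expR (- rho * t))%:E)%E.

Definition admissible_measure (R : realType)
    (lambda : {measure set (measurableTypeR R) -> \bar R}) : Prop :=
  (forall t : R, 0 < t -> (Gbar lambda t < +oo)%E) /\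
  (forall S : R, 0 < S ->
    (\int[lebesgue_measure]_(t in `]0%R, S]) (Gbar lambda t ^+ 2) < +oo)%E).

Definition bounded_measurable_mx (R : realType) (d : nat)
    (M : R -> 'M[R]_d) : Prop :=
  measurable_mx `[0, +oo[ M /\
  exists K : R, forall rho : R, 0 <= rho -> frob_norm (M rho) <= K.

(* Entrywise integral; when M is bounded and measurable on R_+ and lambda is
   admissible, the integrand is lambda-integrable for every t > 0. *)
Definition laplace_kernel (R : realType) (d : nat)
    (lambda : {measure set (measurableTypeR R) -> \bar R}) (M : R -> 'M[R]_d) (t : R) : 'M[R]_d :=
  \matrix_(i, j)
    \int[lambda]_(rho in `[0, +oo[) (expR (- rho * t) * M rho i j).

(* Sigma-algebra generated by a random vector. *)
Definition sigma_vec (R : realType) (d : nat) (Omega : Type)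
    (Y : Omega -> 'cV[R]_d) : set (set Omega) :=
  g_sigma_preimage (fun (i : 'I_d) (w : Omega) => Y w i 0).

(* Only the values of F at times t >= 0 matter. *)
Definition filtration (R : realType) (disp : measure_display)
    (Omega : measurableType disp) (F : R -> set (set Omega)) : Prop :=
  [/\ forall t : R, 0 <= t -> sigma_algebra setT (F t),
      forall t : R, 0 <= t -> F t `<=` measurable
    & forall s t : R, 0 <= s -> s <= t -> F s `<=` F t].

Definition brownian_motion (R : realType) (d : nat) (disp : measure_display)
    (Omega : measurableType disp) (P : probability Omega R)
    (F : R -> set (set Omega)) (W : R -> Omega -> 'cV[R]_d) : Prop :=
  [/\ {ae P, forall w, W 0 w = 0},
      forall t : R, 0 <= t -> sigma_vec (W t) `<=` F t,
      (* W_t - W_s is independent of F_s *)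
      forall s t : R, 0 <= s -> s < t -> forall A B,
        F s A -> sigma_vec (fun w => W t w - W s w) B ->
        P (A `&` B) = (P A * P B)%E,
      (* W_t - W_s has law N(0, (t - s) I_d); the second parameter of
         normal_prob is the standard deviation *)
      forall s t : R, 0 <= s -> s < t -> forall B : 'I_d -> set R,
        (forall i, measurable (B i)) ->
        P [set w | forall i, B i ((W t w - W s w) i 0)] =
        (\prod_(i < d) normal_prob 0 (Num.sqrt (t - s)) (B i))%E
    & {ae P, forall w, forall i,
        {within `[0, +oo[, continuous (fun t => W t w i 0)}}].

(* t_k = kT/N *)
Definition grid (R : realType) (T : R) (N k : nat) : R := k%:R * T / N%:R.

(* X k stands for the scheme at time t_k; only k <= N is constrained, and the
   recursion determines these values uniquely. *)
Definition volterra_euler (R : realType) (d : nat) (Omega : Type)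
    (x0 : 'cV[R]_d) (T : R) (b : 'cV[R]_d -> 'cV[R]_d)
    (sigma : 'cV[R]_d -> 'M[R]_d) (W : R -> Omega -> 'cV[R]_d)
    (G1 G2 : R -> 'M[R]_d) (N : nat) (X : nat -> Omega -> 'cV[R]_d) : Prop :=
  (forall w, X 0%N w = x0) /\
  forall k, (k < N)%N -> forall w,
    X k.+1 w = x0
      + \sum_(0 <= j < k.+1)
          (T / N%:R) *: (G1 (grid T N (k.+1 - j)) *m b (X j w))
      + \sum_(0 <= j < k.+1)
          G2 (grid T N (k.+1 - j)) *m sigma (X j w)
            *m (W (grid T N j.+1) w - W (grid T N j) w).

(* Main.v *)
From HB Require Import structures.
Require Import Defs.
From mathcomp Require Import all_boot all_order all_algebra.
From mathcomp Require Import all_classical all_reals all_analysis.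
From mathcomp Require Import measurable_realfun ring lra.
Import Order.TTheory GRing.Theory Num.Theory.
Import numFieldNormedType.Exports.

Set Implicit Arguments.
Unset Strict Implicit.
Unset Printing Implicit Defensive.

Local Open Scope classical_set_scope.
Local Open Scope ring_scope.

(** The proof is a mean square comparison of the two schemes, closed by a
    Gronwall argument whose constants are uniform in the mesh T / N.

    Each step of a scheme is a sum of a drift and a stochastic part. The drift
    is treated by Cauchy-Schwarz. For the stochastic part, the coefficient in
    front of W_{t_{j+1}} - W_{t_j} is known at time t_j, because a scheme is
    built from earlier increments through continuous, hence measurable,
    coefficients ([measurable_lipschitz_comp], [volterra_euler_adapted]);
    independence and the zero mean of the increments then make the terms
    orthogonal in L^2, and the mean squares add up ([ito_sum_bound]). With
    h = T / N and t_k = k h this yields, for both kinds of terms, a bound by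
    kappa h times the sum over j of ||G(t_{k-j})||^2 times the mean squares of
    the coefficients at time t_j ([volterra_sum_sqr_mean_le]).

    The four kernels have squared norms below one function
    Q = c0 (1 + Gbar ^ 2), which is nonincreasing and integrable on (0, T].
    Monotonicity bounds the Riemann sums of Q, and of Q times a decreasing
    exponential, by the corresponding integrals, for every mesh at once
    ([riemann_sum_le_integral]). By dominated convergence some weight
    e ^ (- theta t) makes the integral of a given multiple of Q as small as
    1/2 ([exponential_weight_small]), and then a Volterra inequality
    u_{k+1} <= A + h sum_j q(t_{k+1-j}) u_j implies
    u_k <= 2 A e ^ (theta t_k) ([volterra_gronwall]).

    This is used twice. First it bounds the second moments of the perturbed
    scheme by a constant B ([volterra_euler_moment]). Then the difference of the
    schemes is split into the effect of replacing the kernels along the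
    perturbed scheme, at most a constant times the right-hand side of the
    theorem, and the effect of the past difference through the original kernels,
    which is a Volterra term in the past errors because b and sigma are
    Lipschitz ([volterra_euler_error]). *)

(** * The centred normal law: symmetry and a second moment bound *)
Section NormalLaw.
Context {R : realType}.
Implicit Types s : R.

(** A Gaussian tail absorbs the factor x ^ 2 if half of the exponent is given
    up: with y = x ^ 2 / (4 s ^ 2) the exponent of the density is - 2 y, and
    y e ^ (- y) <= 1. The remaining e ^ (- y) is, up to normalization, the
    density with standard deviation sqrt 2 * s. This bounds the second moment
    by the total mass of another normal law, with no integration by parts. *)
Lemma sqr_mul_normal_pdf_le s x : 0 < s ->
  x ^+ 2 * normal_pdf 0 s x <= 8 * s ^+ 2 * normal_pdf 0 (Num.sqrt 2 * s) x.
Proof.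
move=> s0; have r2 : Num.sqrt 2 ^+ 2 = 2 :> R by rewrite sqr_sqrtr.
have r20 : 0 < Num.sqrt 2 :> R by rewrite sqrtr_gt0.
have t0 : 0 < Num.sqrt 2 * s by rewrite mulr_gt0.
rewrite !normal_pdfE ?gt_eqF// /normal_fun subr0.
have -> : normal_peak s = Num.sqrt 2 * normal_peak (Num.sqrt 2 * s) :> R.
  rewrite /normal_peak.
  have -> : (Num.sqrt 2 * s) ^+ 2 * pi *+ 2 = 2 * (s ^+ 2 * pi *+ 2) :> R.
    by rewrite exprMn r2; ring.
  by rewrite sqrtrM// invfM mulrA divff ?mul1r// gt_eqF.
set p := normal_peak _.
have p0 : 0 <= p := normal_peak_ge0 _.
set y := x ^+ 2 / (4 * s ^+ 2).
have y0 : 0 <= y.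
  by apply: divr_ge0; [exact: sqr_ge0|apply: mulr_ge0; [exact: ler0n|exact: sqr_ge0]].
have s2 : s != 0 by rewrite gt_eqF.
have -> : - x ^+ 2 / (s ^+ 2 *+ 2) = - y + - y by rewrite /y; field.
have -> : - x ^+ 2 / ((Num.sqrt 2 * s) ^+ 2 *+ 2) = - y.
  by rewrite /y exprMn r2; field.
rewrite expRD.
have x2 : x ^+ 2 = y * 4 * s ^+ 2 by rewrite /y; field.
have yexp : y * expR (- y) <= 1.
  rewrite expRN ler_pdivrMr ?expR_gt0// mul1r.
  by apply: le_trans (expR_ge1Dx y); rewrite lerDr.
have r22 : Num.sqrt 2 <= 2 :> R.
  by rewrite -(@ler_pXn2r _ 2)// ?nnegrE// r2; lra.
rewrite x2.
have -> : y * 4 * s ^+ 2 * (Num.sqrt 2 * p * (expR (- y) * expR (- y))) =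
  (Num.sqrt 2 * (y * expR (- y))) * (4 * s ^+ 2 * (p * expR (- y))) by ring.
have -> : 8 * s ^+ 2 * (p * expR (- y)) = 2 * (4 * s ^+ 2 * (p * expR (- y))).
  by ring.
apply: ler_wpM2r.
  by apply: mulr_ge0; apply: mulr_ge0; rewrite ?ler0n ?sqr_ge0 ?expR_ge0.
rewrite -[leRHS]mulr1; apply: ler_pM => //.
by apply: mulr_ge0 => //; exact: expR_ge0.
Qed.

(** The explicit density agrees almost everywhere with the abstract
    Radon-Nikodym derivative, for which the change of variables is known. *)
Lemma ge0_integral_normal_prob s (f : R -> R) : measurable_fun setT f ->
  (forall x, 0 <= f x) ->
  (\int[normal_prob 0%R s]_x (f x)%:E =
   \int[lebesgue_measure]_x (f x * normal_pdf 0%R s x)%:E)%E.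
Proof.
move=> mf f0; set N := normal_prob 0 s.
rewrite -(Radon_Nikodym_SigmaFinite.change_of_variables
  (normal_prob_dominates 0 s))//; last exact/measurable_EFinP.
have ND := normal_prob_dominates 0 s.
apply: ae_eq_integral => //.
- apply: emeasurable_funM; first exact/measurable_EFinP.
  exact: measurable_int (Radon_Nikodym_SigmaFinite.f_integrable ND).
- apply/measurable_EFinP/measurable_funM => //; exact: measurable_normal_pdf.
- suff: ae_eq lebesgue_measure setT
      (Radon_Nikodym_SigmaFinite.f (normal_prob 0 s) lebesgue_measure)
      (EFin \o normal_pdf 0 s).
    by apply: filterS => x /= /[apply] ->.
  apply: integral_ae_eq => //.
  + exact: Radon_Nikodym_SigmaFinite.f_integrable.
  + apply/measurable_EFinP; exact: measurable_normal_pdf.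
  + by move=> A _ mA; rewrite -Radon_Nikodym_SigmaFinite.f_integral.
Qed.

Lemma normal_prob_second_moment_le s : 0 < s ->
  (\int[normal_prob 0%R s]_x (x ^+ 2)%:E <= (8 * s ^+ 2)%:E)%E.
Proof.
move=> s0; rewrite ge0_integral_normal_prob//; last by move=> x; exact: sqr_ge0.
apply: (@le_trans _ _ (\int[lebesgue_measure]_x
   ((8 * s ^+ 2)%:E * (normal_pdf 0 (Num.sqrt 2 * s) x)%:E))%E).
  apply: ge0_le_integral => //.
  - by move=> x _; rewrite lee_fin mulr_ge0 ?sqr_ge0 ?normal_pdf_ge0.
  - apply/measurable_EFinP/measurable_funM => //; exact: measurable_normal_pdf.
  - apply/measurable_EFinP/measurable_funM => //; exact: measurable_normal_pdf.
  - by move=> x _; rewrite lee_fin sqr_mul_normal_pdf_le.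
rewrite ge0_integralZl//.
- by rewrite integral_normal_pdf mule1.
- apply/measurable_EFinP; exact: measurable_normal_pdf.
- by move=> x _; rewrite lee_fin normal_pdf_ge0.
- by rewrite lee_fin mulr_ge0 ?sqr_ge0.
Qed.

(** The density is even and Lebesgue measure is invariant under x |-> - x. The
    zero mean of the increments will follow from this symmetry. *)
Lemma normal_prob_opp s (A : set R) : s != 0 -> measurable A ->
  normal_prob 0 s (-%R @^-1` A) = normal_prob 0 s A.
Proof.
move=> s0 mA; rewrite /normal_prob.
have mopp : measurable_fun setT (-%R : measurableTypeR R -> measurableTypeR R).
  exact: oppr_measurable.
rewrite [RHS](_ : _ = \int[pushforward lebesgue_measure
    (-%R : _ -> measurableTypeR R)]_(x in A) (normal_pdf 0 s x)%:E)%E; last first.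
  by apply: eq_measure_integral => B mB _; rewrite /= -lebesgue_measureN.
rewrite ge0_integral_pushforward//=.
- apply: eq_integral => x _ /=; congr (_%:E).
  by rewrite !normal_pdfE// /normal_fun !subr0 sqrrN.
- apply: measurable_funTS; apply/measurable_EFinP; exact: measurable_normal_pdf.
- by move=> x _; rewrite lee_fin normal_pdf_ge0.
Qed.

End NormalLaw.

(** * Expectations of products of independent variables *)
Section Independence.
Context d (T : measurableType d) (R : realType) (P : probability T R).

Definition indep_rv (Z Y : T -> R) : Prop := forall A B : set R,
  measurable A -> measurable B ->
  P (Z @^-1` A `&` Y @^-1` B) = (P (Z @^-1` A) * P (Y @^-1` B))%E.

(** Independence prescribes the joint law on rectangles, and rectangles
    determine a finite measure on the plane. *)
Lemma joint_law_prod (Z Y : {RV P >-> R}) (C : set (R * R)) : indep_rv Z Y ->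
  measurable C ->
  (distribution P Z \x distribution P Y)%E C =
  P ((fun w => (Z w, Y w)) @^-1` C).
Proof.
move=> iZY mC.
have mp : measurable_fun setT (fun w => (Z w, Y w)).
  by apply: measurable_fun_pair; exact: measurable_funPT.
pose V : {RV P >-> (R * R)%type} := HB.pack (fun w => (Z w, Y w))
  (isMeasurableFun.Build _ _ _ _ _ mp).
rewrite (@product_measure_unique _ _ _ _ _ _ _ (distribution P V))//.
Qed.

Lemma ge0_expectation_prod (Z Y : T -> R) :
  measurable_fun setT Z -> measurable_fun setT Y -> indep_rv Z Y ->
  (forall w, 0 <= Z w) -> (forall w, 0 <= Y w) ->
  (\int[P]_w (Z w * Y w)%:E = \int[P]_w (Z w)%:E * \int[P]_w (Y w)%:E)%E.
Proof.
move=> mZ mY iZY Z0 Y0.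
pose X1 : {RV P >-> R} := HB.pack Z (isMeasurableFun.Build _ _ _ _ _ mZ).
pose X2 : {RV P >-> R} := HB.pack Y (isMeasurableFun.Build _ _ _ _ _ mY).
have mp : measurable_fun setT (fun w => (Z w, Y w)) by exact: measurable_fun_pair.
pose V : {RV P >-> (R * R)%type} := HB.pack (fun w => (Z w, Y w))
  (isMeasurableFun.Build _ _ _ _ _ mp).
pose f (z : R * R) : \bar R := (`|z.1| * `|z.2|)%:E.
have mf : measurable_fun setT f.
  apply/measurable_EFinP; apply: measurable_funM; exact: measurableT_comp.
have mn : measurable_fun setT (fun y : R => (`|y|)%:E).
  by apply/measurable_EFinP; exact: normr_measurable.
have f0 z : (0 <= f z)%E by rewrite lee_fin mulr_ge0.
transitivity (\int[distribution P V]_z f z)%E.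
  rewrite ge0_integral_distribution//; apply: eq_integral => w _.
  by rewrite /f /= !ger0_norm.
transitivity (\int[distribution P X1 \x distribution P X2]_z f z)%E.
  by apply: eq_measure_integral => C mC _; exact/esym/(@joint_law_prod X1 X2 C iZY mC).
rewrite fubini_tonelli1//=.
transitivity (\int[distribution P X1]_x ((`|x|)%:E * \int[P]_w (Y w)%:E))%E.
  apply: eq_integral => x _; rewrite /fubini_F /f /=.
  under eq_integral do rewrite EFinM.
  rewrite ge0_integralZl//; congr (_ * _)%E.
  rewrite ge0_integral_distribution//; apply: eq_integral => w _.
  by rewrite /= ger0_norm.
rewrite ge0_integralZr//; last by apply: integral_ge0 => w _; rewrite lee_fin.
congr (_ * _)%E; rewrite ge0_integral_distribution//; apply: eq_integral => w _.
by rewrite /= ger0_norm.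
Qed.

(** Once the joint law is a product measure, Fubini lets one integrate the
    centred factor first. *)
Lemma indep_centered_prod (Z Y : T -> R) :
  indep_rv Z Y ->
  P.-integrable setT (EFin \o Z) -> P.-integrable setT (EFin \o Y) ->
  (\int[P]_w (Y w)%:E = 0)%E ->
  P.-integrable setT (EFin \o (Z \* Y)) /\ (\int[P]_w (Z w * Y w)%:E = 0)%E.
Proof.
move=> iZY intZ intY EY.
have mZ : measurable_fun setT Z by apply/measurable_EFinP; exact: measurable_int intZ.
have mY : measurable_fun setT Y by apply/measurable_EFinP; exact: measurable_int intY.
have intZY : P.-integrable setT (EFin \o (Z \* Y)).
  apply/integrableP; split.
    by apply/measurable_EFinP; exact: measurable_funM.
  under eq_integral do rewrite /= normrM.
  rewrite (@ge0_expectation_prod (fun w => `|Z w|) (fun w => `|Y w|))//.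
  - have /integrableP[_ hZ] := intZ; have /integrableP[_ hY] := intY.
    by apply: lte_mul_pinfty => //; rewrite ?integral_ge0//
      ge0_fin_numE// integral_ge0.
  - exact: measurableT_comp.
  - exact: measurableT_comp.
  - move=> A B mA mB; have mn : measurable_fun setT (fun x : R => `|x|) by exact: normr_measurable.
    by apply: (iZY ((fun x => `|x|) @^-1` A) ((fun x => `|x|) @^-1` B));
      rewrite -[X in measurable X]setTI; exact: mn.
split=> //.
pose X1 : {RV P >-> R} := HB.pack Z (isMeasurableFun.Build _ _ _ _ _ mZ).
pose X2 : {RV P >-> R} := HB.pack Y (isMeasurableFun.Build _ _ _ _ _ mY).
have mp : measurable_fun setT (fun w => (Z w, Y w)) by exact: measurable_fun_pair.
pose V : {RV P >-> (R * R)%type} := HB.pack (fun w => (Z w, Y w))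
  (isMeasurableFun.Build _ _ _ _ _ mp).
pose f (z : R * R) : \bar R := (z.1 * z.2)%:E.
have mf : measurable_fun setT f.
  by apply/measurable_EFinP; exact: measurable_funM.
transitivity (\int[distribution P V]_z f z)%E.
  by rewrite integral_distribution.
have laws (A : set (R * R)) : measurable A -> A `<=` setT ->
    distribution P V A = (distribution P X1 \x distribution P X2)%E A.
  by move=> mA _; exact/esym/(@joint_law_prod X1 X2 A iZY mA).
have intf : (distribution P X1 \x distribution P X2)%E.-integrable setT f.
  have : (distribution P V).-integrable setT f.
    by apply: integrable_pushforward.
  move=> /integrableP[_ hf]; apply/integrableP; split => //.
  suff <- : (\int[distribution P V]_z `|f z| =
    \int[distribution P X1 \x distribution P X2]_z `|f z|)%E by [].
  exact: eq_measure_integral.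
transitivity (\int[distribution P X1 \x distribution P X2]_z f z)%E.
  exact: eq_measure_integral.
rewrite -integral12_prod_meas1//.
rewrite integral0_eq// => x _; rewrite /fubini_F /f /=.
have int2 : (distribution P X2).-integrable setT (EFin \o (id : R -> R)).
  by apply: integrable_pushforward => //; exact: EFin_measurable.
under eq_integral do rewrite EFinM.
rewrite integralZl//.
rewrite (@integral_distribution _ _ _ _ _ P X2 (EFin \o id))//.
  by rewrite /= EY mule0.
exact: EFin_measurable.
Qed.

End Independence.

(** * Cauchy-Schwarz for finite sums *)
Section CauchySchwarz.
Context {R : realType}.

(** Lagrange's identity: the defect is half of the sum of the squares
    (a i * b j - a j * b i) ^ 2. *)
Lemma cauchy_schwarz (I : Type) (r : seq I) (a b : I -> R) :
  (\sum_(i <- r) a i * b i) ^+ 2 <=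
  (\sum_(i <- r) a i ^+ 2) * (\sum_(i <- r) b i ^+ 2).
Proof.
have : 0 <= \sum_(i <- r) \sum_(j <- r) (a i * b j - a j * b i) ^+ 2.
  by apply: sumr_ge0 => i _; apply: sumr_ge0 => j _; exact: sqr_ge0.
have -> : \sum_(i <- r) \sum_(j <- r) (a i * b j - a j * b i) ^+ 2 =
  \sum_(i <- r) \sum_(j <- r) (a i ^+ 2 * b j ^+ 2)
  + \sum_(i <- r) \sum_(j <- r) (b i ^+ 2 * a j ^+ 2)
  - 2 * \sum_(i <- r) \sum_(j <- r) (a i * b i) * (a j * b j).
  rewrite mulr_sumr -big_split -sumrB; apply: eq_bigr => i _.
  rewrite mulr_sumr -big_split -sumrB; apply: eq_bigr => j _ /=; ring.
by rewrite -!big_distrlr /= => h; rewrite expr2; lra.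
Qed.

Lemma sqr_sum_le (I : Type) (r : seq I) (a : I -> R) :
  (\sum_(i <- r) a i) ^+ 2 <= (size r)%:R * \sum_(i <- r) a i ^+ 2.
Proof.
have := cauchy_schwarz r (fun=> 1) a.
under eq_bigr do rewrite mul1r.
by rewrite expr1n big_const_seq count_predT iter_addr_0.
Qed.

End CauchySchwarz.

(** * Upper bounds on expectations *)
Section MeanBounds.
Context d (T : measurableType d) (R : realType) (P : probability T R).
Implicit Types f g Y Z : T -> R.

(** A real upper bound m on the expectation of f, bundled with the
    measurability and sign of f. Bounds of this form can be added, scaled and
    compared with real arithmetic only, and they make f integrable. *)
Definition mean_le f (m : R) : Prop :=
  [/\ measurable_fun setT f, forall w, 0 <= f w
    & (\int[P]_w (f w)%:E <= m%:E)%E].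

Lemma mean_le_integrable f m : mean_le f m -> P.-integrable setT (EFin \o f).
Proof.
move=> [mf f0 fm]; apply/integrableP; split; first exact/measurable_EFinP.
under eq_integral do rewrite /= ger0_norm//.
by apply: le_lt_trans fm _; rewrite ltry.
Qed.

Lemma mean_le_mono f m m' : mean_le f m -> m <= m' -> mean_le f m'.
Proof. by move=> [? ? fm] mm'; split => //; apply: le_trans fm _; rewrite lee_fin. Qed.

Lemma mean_le_ge0 f m : mean_le f m -> 0 <= m.
Proof.
move=> [_ f0 fm]; rewrite -lee_fin; apply: le_trans fm.
by apply: integral_ge0 => w _; rewrite lee_fin.
Qed.

Lemma mean_le_dom f g m : measurable_fun setT f -> (forall w, 0 <= f w <= g w) ->
  mean_le g m -> mean_le f m.
Proof.
move=> mf fg [mg g0 gm]; split => // [w|]; first by have /andP[] := fg w.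
apply: le_trans gm; apply: ge0_le_integral => //.
- by move=> w _; rewrite lee_fin; have /andP[] := fg w.
- exact/measurable_EFinP.
- exact/measurable_EFinP.
- by move=> w _; rewrite lee_fin; have /andP[] := fg w.
Qed.

Lemma mean_le_cst (c : R) : 0 <= c -> mean_le (fun=> c) c.
Proof.
by move=> c0; split => //; rewrite integral_cst//= probability_setT mule1.
Qed.

Lemma mean_leD f g m m' : mean_le f m -> mean_le g m' ->
  mean_le (fun w => f w + g w) (m + m').
Proof.
move=> [mf f0 fm] [mg g0 gm]; split.
- exact: measurable_funD.
- by move=> w; rewrite addr_ge0.
- under eq_integral do rewrite EFinD.
  rewrite ge0_integralD//.
  + by rewrite EFinD leeD.
  + by move=> w _; rewrite lee_fin.
  + exact/measurable_EFinP.
  + by move=> w _; rewrite lee_fin.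
  + exact/measurable_EFinP.
Qed.

Lemma mean_leZ (c : R) f m : 0 <= c -> mean_le f m ->
  mean_le (fun w => c * f w) (c * m).
Proof.
move=> c0 [mf f0 fm]; split.
- exact: measurable_funM.
- by move=> w; rewrite mulr_ge0.
- under eq_integral do rewrite EFinM.
  rewrite ge0_integralZl//.
  + by rewrite EFinM lee_wpmul2l.
  + exact/measurable_EFinP.
  + by move=> w _; rewrite lee_fin.
Qed.

Lemma mean_le_sum (I : eqType) (r : seq I) (f : I -> T -> R) (m : I -> R) :
  (forall i, i \in r -> mean_le (f i) (m i)) ->
  mean_le (fun w => \sum_(i <- r) f i w) (\sum_(i <- r) m i).
Proof.
elim: r => [|i r ih] h.
  under [X in mean_le X]funext do rewrite big_nil.
  by rewrite big_nil; exact: mean_le_cst.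
under [X in mean_le X]funext do rewrite big_cons.
rewrite big_cons; apply: mean_leD; first by apply: h; exact: mem_head.
by apply: ih => j jr; apply: h; rewrite inE jr orbT.
Qed.

Lemma mean_leM f g m m' : indep_rv P f g -> mean_le f m -> mean_le g m' ->
  mean_le (fun w => f w * g w) (m * m').
Proof.
move=> ifg [mf f0 fm] [mg g0 gm]; split.
- exact: measurable_funM.
- by move=> w; rewrite mulr_ge0.
- rewrite ge0_expectation_prod// EFinM; apply: lee_pmul => //;
    by apply: integral_ge0 => w _; rewrite lee_fin.
Qed.

Lemma mean_le_sqr_integrableM f g m m' :
  measurable_fun setT f -> measurable_fun setT g ->
  mean_le (fun w => f w ^+ 2) m -> mean_le (fun w => g w ^+ 2) m' ->
  P.-integrable setT (EFin \o (f \* g)).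
Proof.
move=> mf mg fm gm.
have := mean_le_integrable (mean_leD fm gm).
apply: le_integrable => //.
  by apply/measurable_EFinP; exact: measurable_funM.
move=> w _ /=; rewrite lee_fin normrM [leRHS]ger0_norm ?addr_ge0 ?sqr_ge0//.
rewrite -(real_normK (num_real (f w))) -(real_normK (num_real (g w))).
have := sqr_ge0 (`|f w| - `|g w|); have := mulr_ge0 (normr_ge0 (f w)) (normr_ge0 (g w)).
by rewrite !expr2; nra.
Qed.

Lemma mean_le_sqr_integrable f m : measurable_fun setT f ->
  mean_le (fun w => f w ^+ 2) m -> P.-integrable setT (EFin \o f).
Proof.
move=> mf fm.
have m1 : mean_le (fun w => (cst 1 : T -> R) w ^+ 2) 1.
  by under [X in mean_le X]funext do rewrite expr1n; exact: mean_le_cst.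
have := mean_le_sqr_integrableM mf (measurable_cst _) fm m1.
by apply: eq_integrable => // w _; rewrite /= mulr1.
Qed.

(** Pythagoras in L^2: the cross term integrates to zero. *)
Lemma mean_le_sqr_orthogonal f g m m' :
  measurable_fun setT f -> measurable_fun setT g ->
  mean_le (fun w => f w ^+ 2) m -> mean_le (fun w => g w ^+ 2) m' ->
  (\int[P]_w (f w * g w)%:E = 0)%E ->
  mean_le (fun w => (f w + g w) ^+ 2) (m + m').
Proof.
move=> mf mg fm gm fg0; have ifg := mean_le_sqr_integrableM mf mg fm gm.
split.
- by apply: measurable_funX; exact: measurable_funD.
- by move=> w; exact: sqr_ge0.
have -> : (\int[P]_w ((f w + g w) ^+ 2)%:E =
    \int[P]_w ((f w ^+ 2 + g w ^+ 2)%:E + (2%:E * (f w * g w)%:E)))%E.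
  by apply: eq_integral => w _; rewrite -EFinM -EFinD; congr EFin; ring.
have fgm := mean_leD fm gm.
rewrite integralD//.
- rewrite integralZl// fg0 mule0 adde0.
  by have [] := fgm.
- exact: mean_le_integrable fgm.
- exact: (integrableZl measurableT).
Qed.

End MeanBounds.

(** * Variables with a centred normal law *)
Section NormalVariable.
Context d (T : measurableType d) (R : realType) (P : probability T R).
Variables (Y : T -> R) (s : R).
Hypotheses (mY : measurable_fun setT Y) (s0 : 0 < s).
Hypothesis lawY : forall B, measurable B -> P (Y @^-1` B) = normal_prob 0 s B.

Lemma normal_sqr_mean_le : mean_le P (fun w => Y w ^+ 2) (8 * s ^+ 2).
Proof.
split; [exact: measurable_funX|by move=> w; exact: sqr_ge0|].
have mY' : measurable_fun setT (Y : T -> measurableTypeR R) := mY.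
pose X : {RV P >-> measurableTypeR R} :=
  HB.pack Y (isMeasurableFun.Build _ _ _ _ _ mY').
apply: le_trans (normal_prob_second_moment_le s0).
rewrite le_eqVlt; apply/orP; left; apply/eqP.
transitivity (\int[distribution P X]_x (x ^+ 2)%:E)%E.
  rewrite ge0_integral_distribution//.
  - by apply/measurable_EFinP; exact: exprn_measurable.
  - by move=> x; rewrite lee_fin sqr_ge0.
apply: (@eq_measure_integral _ _ _ _ (normal_prob 0 s) (distribution P X)).
by move=> B mB _; exact: lawY.
Qed.

(** The variables Y and - Y have the same law, so the expectation of Y, which
    is finite, equals its opposite. *)
Lemma normal_centered : (\int[P]_w (Y w)%:E = 0)%E.
Proof.
have intY := mean_le_sqr_integrable mY normal_sqr_mean_le.
have mNY : measurable_fun setT (fun w => - Y w) by exact: measurable_funN.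
pose X : {RV P >-> R} := HB.pack Y (isMeasurableFun.Build _ _ _ _ _ mY).
pose X' : {RV P >-> R} := HB.pack (fun w => - Y w)
  (isMeasurableFun.Build _ _ _ _ _ mNY).
have opp : (\int[P]_w (Y w)%:E = \int[P]_w (- Y w)%:E)%E.
  transitivity (\int[distribution P X]_x (x%:E))%E.
    by rewrite integral_distribution.
  transitivity (\int[distribution P X']_x (x%:E))%E; last first.
    rewrite integral_distribution//.
    by have := integrableN intY; apply: eq_integrable.
  apply: eq_measure_integral => B mB _.
  rewrite [LHS]lawY//.
  rewrite -[LHS]normal_prob_opp ?gt_eqF// -lawY//.
  by rewrite -[X in measurable X]setTI; exact: oppr_measurable.
move: opp; under [X in _ = X -> _]eq_integral do rewrite EFinN.
rewrite integralN; last exact: integrable_add_def.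
have := integrable_fin_num measurableT intY.
by case: (\int[P]_w (Y w)%:E)%E => //= r _ [] h; congr EFin; lra.
Qed.

End NormalVariable.

(** * Euclidean and Frobenius norms *)
Section Norms.
Context {R : realType} {d : nat}.
Implicit Types (x y : 'cV[R]_d) (A : 'M[R]_d).

Lemma euclid_norm_ge0 x : 0 <= euclid_norm x.
Proof. exact: sqrtr_ge0. Qed.

Lemma frob_norm_ge0 A : 0 <= frob_norm A.
Proof. exact: sqrtr_ge0. Qed.

Lemma sqr_euclid_norm x : euclid_norm x ^+ 2 = \sum_i x i 0 ^+ 2.
Proof. by rewrite sqr_sqrtr//; apply: sumr_ge0 => i _; exact: sqr_ge0. Qed.

Lemma sqr_frob_norm A : frob_norm A ^+ 2 = \sum_i \sum_j A i j ^+ 2.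
Proof.
rewrite sqr_sqrtr//; apply: sumr_ge0 => i _; apply: sumr_ge0 => j _.
exact: sqr_ge0.
Qed.

Lemma euclid_norm0 : euclid_norm (0 : 'cV[R]_d) = 0.
Proof.
by rewrite /euclid_norm big1 ?sqrtr0// => i _; rewrite mxE expr0n.
Qed.

Lemma coord_le_euclid_norm x i : `|x i 0| <= euclid_norm x.
Proof.
rewrite -(@ler_pXn2r _ 2)// ?nnegrE ?euclid_norm_ge0// real_normK ?num_real//.
rewrite sqr_euclid_norm (bigD1 i)//= lerDl; apply: sumr_ge0 => j _.
exact: sqr_ge0.
Qed.

Lemma coord_le_frob_norm A i j : `|A i j| <= frob_norm A.
Proof.
rewrite -(@ler_pXn2r _ 2)// ?nnegrE ?frob_norm_ge0// real_normK ?num_real//.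
rewrite sqr_frob_norm (bigD1 i)//= (bigD1 j)//= -addrA lerDl addr_ge0//.
  by apply: sumr_ge0 => k _; exact: sqr_ge0.
by apply: sumr_ge0 => k _; apply: sumr_ge0 => l _; exact: sqr_ge0.
Qed.

Lemma euclid_norm_le_sum x : euclid_norm x <= \sum_i `|x i 0|.
Proof.
have s0 : 0 <= \sum_i `|x i 0| by exact: sumr_ge0.
rewrite -(@ler_pXn2r _ 2)// ?nnegrE ?euclid_norm_ge0//.
rewrite sqr_euclid_norm [leRHS]expr2 mulr_suml; apply: ler_sum => i _.
rewrite -(real_normK (num_real (x i 0))) expr2 ler_wpM2l//.
by rewrite (bigD1 i)//= lerDl sumr_ge0.
Qed.

Lemma sqr_euclid_norm_mulmx_le A x :
  euclid_norm (A *m x) ^+ 2 <= frob_norm A ^+ 2 * euclid_norm x ^+ 2.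
Proof.
rewrite !sqr_euclid_norm sqr_frob_norm mulr_suml; apply: ler_sum => i _.
by rewrite mxE; exact: cauchy_schwarz.
Qed.

Lemma sqr_frob_norm_mulmx_le A B :
  frob_norm (A *m B) ^+ 2 <= frob_norm A ^+ 2 * frob_norm B ^+ 2.
Proof.
rewrite !sqr_frob_norm mulr_suml; apply: ler_sum => i _.
rewrite [X in _ <= _ * X]exchange_big mulr_sumr; apply: ler_sum => j _.
by rewrite mxE; exact: cauchy_schwarz.
Qed.

Lemma sqr_euclid_norm_sum_le (I : Type) (r : seq I) (v : I -> 'cV[R]_d) :
  euclid_norm (\sum_(i <- r) v i) ^+ 2 <=
  (size r)%:R * \sum_(i <- r) euclid_norm (v i) ^+ 2.
Proof.
rewrite sqr_euclid_norm.
under [X in _ <= _ * X]eq_bigr do rewrite sqr_euclid_norm.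
rewrite exchange_big mulr_sumr; apply: ler_sum => k _.
by rewrite summxE; exact: sqr_sum_le.
Qed.

Lemma sqr_euclid_normD_le x y :
  euclid_norm (x + y) ^+ 2 <= 2 * euclid_norm x ^+ 2 + 2 * euclid_norm y ^+ 2.
Proof.
have := sqr_euclid_norm_sum_le [:: x; y] id.
by rewrite !big_cons !big_nil !addr0 /= mulrDr.
Qed.

Lemma sqr_euclid_normZ (c : R) x :
  euclid_norm (c *: x) ^+ 2 = c ^+ 2 * euclid_norm x ^+ 2.
Proof.
rewrite !sqr_euclid_norm mulr_sumr; apply: eq_bigr => i _.
by rewrite mxE exprMn.
Qed.

Lemma sqr_frob_normD_le A B :
  frob_norm (A + B) ^+ 2 <= 2 * frob_norm A ^+ 2 + 2 * frob_norm B ^+ 2.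
Proof.
rewrite !sqr_frob_norm !mulr_sumr -big_split; apply: ler_sum => i _ /=.
rewrite !mulr_sumr -big_split; apply: ler_sum => j _ /=.
rewrite mxE; have := sqr_ge0 (A i j - B i j); rewrite !expr2; lra.
Qed.

(** Rational vectors are the countable dense set over which Lipschitz functions
    are expressed as infima. *)
Lemma rat_cV_dense x (e : R) : 0 < e ->
  exists q : 'cV[rat]_d, euclid_norm (x - map_mx ratr q) < e.
Proof.
move=> e0.
have e'0 : 0 < e / d.+1%:R by rewrite divr_gt0.
have h i : exists q : rat, `|x i 0 - ratr q| < e / d.+1%:R.
  have : x i 0 - e / d.+1%:R < x i 0 + e / d.+1%:R.
    by move: e'0; move: (e / _) => e1; lra.
  move=> /rat_in_itvoo[q]; rewrite in_itv /= => /andP[q1 q2].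
  by exists q; move: (e / _) q1 q2 => e1; rewrite ltr_norml; lra.
exists (\col_i sval (cid (h i))).
apply: le_lt_trans (euclid_norm_le_sum _) _.
apply: (@le_lt_trans _ _ (\sum_(i < d) e / d.+1%:R)).
  apply: ler_sum => i _; rewrite !mxE; apply: ltW.
  by case: (cid (h i)).
rewrite sumr_const card_ord.
have {2}-> : e = e / d.+1%:R *+ d.+1 by rewrite -mulr_natr divfK// pnatr_eq0.
by rewrite (mulrS (e / d.+1%:R)) ltrDr.
Qed.

End Norms.

(** * Lipschitz functions of random vectors *)
(** A Lipschitz function is the infimum of the cones f q + L |y - q| with
    rational apex q, so [f (Y w) < a] is a countable union of events on which
    one of these cones lies below a at Y w. *)
Lemma measurable_lipschitz_comp disp (T : measurableType disp) (R : realType)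
    (d : nat) (f : 'cV[R]_d -> R) (L : R) (Y : T -> 'cV[R]_d) :
  (forall x y, `|f x - f y| <= L * euclid_norm (x - y)) ->
  (forall i, measurable_fun setT (fun w => Y w i 0)) ->
  measurable_fun setT (fun w => f (Y w)).
Proof.
move=> fL mY.
pose r (q : 'cV[rat]_d) : 'cV[R]_d := map_mx ratr q.
have mr q : measurable_fun setT (fun w => f (r q) + L * euclid_norm (Y w - r q)).
  apply: measurable_funD => //; apply: measurable_funM => //.
  apply: (measurableT_comp (f := @Num.sqrt R)).
    exact: continuous_measurable_fun (@sqrt_continuous R).
  apply: measurable_sum => i; apply: measurable_funX.
  under eq_fun do rewrite !mxE.
  exact: measurable_funB.
apply: (measurability (@RGenInftyO.G R)) => [|/= _ [_] [a] -> <-].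
  exact: RGenInftyO.measurableE.
rewrite setTI.
have -> : (fun w => f (Y w)) @^-1` `]-oo, a[ =
    \bigcup_q ((fun w => f (r q) + L * euclid_norm (Y w - r q)) @^-1` `]-oo, a[).
  apply/seteqP; split=> w /=; rewrite in_itv/= => h.
    (* a factor 2 L on the distance must fit in the gap a - f (Y w) *)
    have c0 : 0 < 2 * `|L| + 1 by rewrite ltr_wpDl// mulr_ge0.
    have e0 : 0 < (a - f (Y w)) / (2 * `|L| + 1) by rewrite divr_gt0// subr_gt0.
    have [q] := rat_cV_dense (Y w) e0; rewrite ltr_pdivlMr// => hq.
    exists q => //=; rewrite in_itv/=.
    have := fL (Y w) (r q); rewrite ler_norml => /andP[+ _].
    have : L * euclid_norm (Y w - r q) <= `|L| * euclid_norm (Y w - r q).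
      by apply: ler_wpM2r (ler_norm _); exact: euclid_norm_ge0.
    have := euclid_norm_ge0 (Y w - r q).
    by move: hq; rewrite -/(r q); lra.
  case: h => q _ /=; rewrite in_itv/=; apply: le_lt_trans.
  have := fL (Y w) (r q); rewrite ler_norml => /andP[_]; lra.
apply: countable_bigcupT_measurable => [|q]; first exact: countableP.
by rewrite -[X in measurable X]setTI; exact: mr.
Qed.

(** * Variables measurable for a sub-sigma-algebra *)
Section Adapted.
Context (R : realType) (disp : measure_display) (Omega : measurableType disp).
Implicit Types (G : set (set Omega)) (Z : Omega -> R).

(** Measurability for G, as a bare set of events: [adaptedP] turns it into
    measurability on the type Omega equipped with G. *)
Definition adapted G Z : Prop :=
  forall B : set R, measurable B -> G (Z @^-1` B).

Lemma adaptedP G Z : sigma_algebra setT G ->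
  adapted G Z <-> @measurable_fun _ _ (g_sigma_algebraType G) R setT Z.
Proof.
move=> sG; split=> [aZ _ B mB|mZ B mB].
  by rewrite setTI; apply: sub_sigma_algebra; exact: aZ.
have := mZ measurableT B mB.
by rewrite setTI /measurable/= sigma_algebra_id.
Qed.

Lemma adapted_sub G G' Z : G `<=` G' -> adapted G Z -> adapted G' Z.
Proof. by move=> GG' aZ B mB; exact/GG'/aZ. Qed.

Lemma adapted_measurable G Z : G `<=` measurable -> adapted G Z ->
  measurable_fun setT Z.
Proof. by move=> Gm aZ _ B mB; rewrite setTI; exact/Gm/aZ. Qed.

Lemma adapted_lipschitz_comp G (d : nat) (f : 'cV[R]_d -> R) (L : R)
    (Y : Omega -> 'cV[R]_d) : sigma_algebra setT G ->
  (forall x y, `|f x - f y| <= L * euclid_norm (x - y)) ->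
  (forall i, adapted G (fun w => Y w i 0)) -> adapted G (fun w => f (Y w)).
Proof.
move=> sG fL aY; apply/adaptedP => //.
apply: (@measurable_lipschitz_comp _ (g_sigma_algebraType G) _ _ _ _ _ fL) => i.
exact/adaptedP.
Qed.

Lemma adapted_cst G (c : R) : sigma_algebra setT G -> adapted G (fun=> c).
Proof. by move=> sG; apply/adaptedP => //; exact: measurable_cst. Qed.

Lemma adaptedD G Z Z' : sigma_algebra setT G -> adapted G Z -> adapted G Z' ->
  adapted G (fun w => Z w + Z' w).
Proof.
move=> sG /adaptedP-/(_ sG) mZ /adaptedP-/(_ sG) mZ'; apply/adaptedP => //.
exact: measurable_funD.
Qed.

Lemma adaptedM G Z Z' : sigma_algebra setT G -> adapted G Z -> adapted G Z' ->
  adapted G (fun w => Z w * Z' w).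
Proof.
move=> sG /adaptedP-/(_ sG) mZ /adaptedP-/(_ sG) mZ'; apply/adaptedP => //.
exact: measurable_funM.
Qed.

Lemma adapted_sum G (I : eqType) (r : seq I) (Z : I -> Omega -> R) :
  sigma_algebra setT G -> (forall i, i \in r -> adapted G (Z i)) ->
  adapted G (fun w => \sum_(i <- r) Z i w).
Proof.
move=> sG; elim: r => [|i r ih] h.
  by under [X in adapted _ X]funext do rewrite big_nil; exact: adapted_cst.
under [X in adapted _ X]funext do rewrite big_cons.
apply: adaptedD => //; first by apply: h; exact: mem_head.
by apply: ih => j jr; apply: h; rewrite inE jr orbT.
Qed.

End Adapted.

(** * Brownian increments and the discrete Ito inequality *)
Section BrownianIncrements.
Context (R : realType) (d : nat) (disp : measure_display).
Context (Omega : measurableType disp) (P : probability Omega R).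
Variables (F : R -> set (set Omega)) (W : R -> Omega -> 'cV[R]_d).
Hypotheses (hF : filtration F) (hW : brownian_motion P F W).

Definition increment (s t : R) (m : 'I_d) (w : Omega) : R := (W t w - W s w) m 0.

Lemma filtration_sigma t : 0 <= t -> sigma_algebra setT (F t).
Proof. by case: hF => h _ _; exact: h. Qed.

Lemma filtration_measurable t : 0 <= t -> F t `<=` measurable.
Proof. by case: hF => _ h _; exact: h. Qed.

Lemma filtration_mono s t : 0 <= s -> s <= t -> F s `<=` F t.
Proof. by case: hF => _ _ h; exact: h. Qed.

Lemma sigma_vec_coord (Y : Omega -> 'cV[R]_d) i (B : set R) : measurable B ->
  sigma_vec Y ((fun w => Y w i 0) @^-1` B).
Proof.
move=> mB; apply: sub_sigma_algebra; rewrite (bigD1 i)//=; left.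
by exists B => //; rewrite setTI.
Qed.

Lemma brownian_adapted t i : 0 <= t -> adapted (F t) (fun w => W t w i 0).
Proof.
by case: hW => _ h _ _ _ t0 B mB; apply: h => //; exact: sigma_vec_coord.
Qed.

Lemma increment_adapted s t m : 0 <= s -> s <= t ->
  adapted (F t) (increment s t m).
Proof.
move=> s0 st; have t0 := le_trans s0 st.
have sF := filtration_sigma t0.
under [X in adapted _ X]funext do rewrite /increment !mxE -mulN1r.
apply: adaptedD => //; first exact: brownian_adapted.
apply: adaptedM => //; first exact: adapted_cst.
by apply: adapted_sub (filtration_mono s0 st) _; exact: brownian_adapted.
Qed.

Lemma increment_measurable s t m : 0 <= s -> s <= t ->
  measurable_fun setT (increment s t m).
Proof.
move=> s0 st; apply: adapted_measurable (increment_adapted _ s0 st).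
exact: filtration_measurable (le_trans s0 st).
Qed.

Lemma increment_indep s t m (Z : Omega -> R) : 0 <= s -> s < t ->
  adapted (F s) Z -> indep_rv P Z (increment s t m).
Proof.
case: hW => _ _ h _ _ s0 st aZ A B mA mB; apply: (h s t) => //.
  exact: aZ.
exact: (@sigma_vec_coord (fun w => W t w - W s w)).
Qed.

(** One marginal of the d-dimensional normal law: all the other coordinates are
    left free. *)
Lemma increment_law s t m B : 0 <= s -> s < t -> measurable B ->
  P (increment s t m @^-1` B) = normal_prob 0 (Num.sqrt (t - s)) B.
Proof.
case: hW => _ _ _ h _ s0 st mB.
have := h s t s0 st (fun i => if i == m then B else setT).
rewrite (bigD1 m)//= eqxx big1; last first.
  by move=> i /negPf ->; exact: probability_setT.
rewrite mule1 => <-; last by move=> i; case: ifP.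
congr (P _); apply/seteqP; split=> w /=; last by move=> /(_ m); rewrite eqxx.
by move=> Bw i; case: ifP => // /eqP ->.
Qed.

Lemma increment_sqr_mean_le s t m : 0 <= s -> s < t ->
  mean_le P (fun w => increment s t m w ^+ 2) (8 * (t - s)).
Proof.
move=> s0 st; have h : 0 < Num.sqrt (t - s) by rewrite sqrtr_gt0 subr_gt0.
have := normal_sqr_mean_le (increment_measurable m s0 (ltW st)) h.
by rewrite sqr_sqrtr ?subr_ge0 1?ltW//; apply => B mB; exact: increment_law.
Qed.

Lemma increment_integral0 s t m : 0 <= s -> s < t ->
  (\int[P]_w (increment s t m w)%:E = 0)%E.
Proof.
move=> s0 st; have h : 0 < Num.sqrt (t - s) by rewrite sqrtr_gt0 subr_gt0.
apply: (normal_centered (increment_measurable m s0 (ltW st)) h) => B mB.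
exact: increment_law.
Qed.

Lemma increment_integrable s t m : 0 <= s -> s < t ->
  P.-integrable setT (EFin \o increment s t m).
Proof.
move=> s0 st.
exact: mean_le_sqr_integrable (increment_measurable m s0 (ltW st))
  (increment_sqr_mean_le m s0 st).
Qed.

Section Step.
Variables (s t : R) (a : 'I_d -> Omega -> R) (v : 'I_d -> R).
Hypotheses (s0 : 0 <= s) (st : s < t).
Hypothesis aF : forall m, adapted (F s) (a m).
Hypothesis av : forall m, mean_le P (fun w => a m w ^+ 2) (v m).

Definition ito_increment (w : Omega) := \sum_m a m w * increment s t m w.

Let ma m : measurable_fun setT (a m).
Proof. exact: adapted_measurable (filtration_measurable s0) (aF m). Qed.

Let mincr m : measurable_fun setT (increment s t m).
Proof. exact: increment_measurable s0 (ltW st). Qed.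

Lemma ito_increment_adapted : adapted (F t) ito_increment.
Proof.
have t0 := le_trans s0 (ltW st); have sF := filtration_sigma t0.
apply: adapted_sum => // m _; apply: adaptedM => //.
  exact: adapted_sub (filtration_mono s0 (ltW st)) (aF m).
exact: increment_adapted (ltW st).
Qed.

(** By Cauchy-Schwarz over the d coordinates it is enough to bound the mean of
    each a_m ^ 2 (W_t - W_s)_m ^ 2, a product of independent variables. *)
Lemma ito_increment_sqr_mean_le :
  mean_le P (fun w => ito_increment w ^+ 2) (d%:R * (8 * (t - s) * \sum_m v m)).
Proof.
have t0 := le_trans s0 (ltW st).
have b : mean_le P (fun w => d%:R * \sum_m (a m w ^+ 2 * increment s t m w ^+ 2))
    (d%:R * (8 * (t - s) * \sum_m v m)).
  apply: mean_leZ => //; rewrite mulr_sumr; apply: mean_le_sum => m _.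
  rewrite mulrC; apply: mean_leM => //; last exact: increment_sqr_mean_le.
  move=> A B mA mB.
  have mX : measurable_fun setT (fun x : R => x ^+ 2) by exact: exprn_measurable.
  apply: (increment_indep m s0 st (aF m) (A := (fun x => x ^+ 2) @^-1` A)
    (B := (fun x => x ^+ 2) @^-1` B));
    by rewrite -[X in measurable X]setTI; exact: mX.
apply: mean_le_dom b.
  apply: measurable_funX; apply: adapted_measurable (ito_increment_adapted).
  exact: filtration_measurable.
move=> w; rewrite sqr_ge0 /=.
apply: le_trans (sqr_sum_le _ _) _.
rewrite -sum1_size big_const_ord iter_addn_0 mul1n.
by rewrite ler_wpM2l//; apply: ler_sum => m _; rewrite exprMn.
Qed.

(** The past S multiplies a_m into a variable known at time s, hence independent
    of the centred increment. *)
Lemma ito_increment_orthogonal (S : Omega -> R) (c : R) :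
  adapted (F s) S -> mean_le P (fun w => S w ^+ 2) c ->
  (\int[P]_w (S w * ito_increment w)%:E = 0)%E.
Proof.
move=> aS Sc.
have mS : measurable_fun setT S.
  exact: adapted_measurable (filtration_measurable s0) aS.
have H m : P.-integrable setT (EFin \o ((S \* a m) \* increment s t m)) /\
    (\int[P]_w ((S w * a m w) * increment s t m w)%:E = 0)%E.
  apply: (@indep_centered_prod _ _ _ _ (S \* a m)).
  - apply: increment_indep => //; apply: adaptedM => //; exact: filtration_sigma.
  - exact: mean_le_sqr_integrableM Sc (av m).
  - exact: increment_integrable.
  - exact: increment_integral0.
transitivity (\int[P]_w (\sum_m ((S w * a m w) * increment s t m w)%:E))%E.
  apply: eq_integral => w _; rewrite sumEFin mulr_sumr; congr EFin.
  by apply: eq_bigr => m _; rewrite mulrA.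
rewrite integral_sum//; last by move=> m; have [] := H m.
by rewrite big1// => m _; have [] := H m.
Qed.

End Step.

(** The Ito isometry for step processes, as an inequality: the new increment is
    orthogonal to the sum of the previous ones, so mean squares add up. The two
    conclusions are proved together because orthogonality at step n uses that
    the partial sum is known at time t n. *)
Lemma ito_sum_bound (h : R) (t : nat -> R) (a : nat -> 'I_d -> Omega -> R)
    (v : nat -> 'I_d -> R) (n : nat) :
  0 < h -> (forall j, 0 <= t j) -> (forall j, t j.+1 = t j + h) ->
  (forall j m, (j < n)%N -> adapted (F (t j)) (a j m)) ->
  (forall j m, (j < n)%N -> mean_le P (fun w => a j m w ^+ 2) (v j m)) ->
  adapted (F (t n)) (fun w => \sum_(0 <= j < n) ito_increment (t j) (t j.+1) (a j) w) /\
  mean_le P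
    (fun w => (\sum_(0 <= j < n) ito_increment (t j) (t j.+1) (a j) w) ^+ 2)
    (\sum_(0 <= j < n) d%:R * (8 * h * \sum_m v j m)).
Proof.
move=> h0 t0 tS.
have tlt j : t j < t j.+1 by rewrite tS ltrDl.
elim: n => [_ _|n ih aF av].
  rewrite big_geq//; under [X in adapted _ X]funext do rewrite big_geq//.
  under [X in mean_le _ X]funext do rewrite big_geq// expr0n.
  split; last exact: mean_le_cst.
  by apply: adapted_cst; exact: filtration_sigma.
have [aS mS] := ih (fun j m jn => aF j m (ltnW jn)) (fun j m jn => av j m (ltnW jn)).
have aI := ito_increment_adapted (t0 n) (tlt n) (fun m => aF n m (ltnSn n)).
have aS' : adapted (F (t n.+1))
    (fun w => \sum_(0 <= j < n) ito_increment (t j) (t j.+1) (a j) w).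
  exact: adapted_sub (filtration_mono (t0 n) (ltW (tlt n))) aS.
have sF := filtration_sigma (t0 n.+1).
have mF := filtration_measurable (t0 n.+1).
split.
  under [X in adapted _ X]funext do rewrite big_nat_recr//=.
  exact: adaptedD.
under [X in mean_le _ X]funext do rewrite big_nat_recr//=.
rewrite big_nat_recr//=; apply: mean_le_sqr_orthogonal.
- exact: adapted_measurable mF aS'.
- exact: adapted_measurable mF aI.
- exact: mS.
- have := ito_increment_sqr_mean_le (t0 n) (tlt n) (fun m => aF n m (ltnSn n))
    (fun m => av n m (ltnSn n)).
  by have -> : t n.+1 - t n = h by rewrite tS addrAC subrr add0r.
- exact: (ito_increment_orthogonal (t0 n) (tlt n) (fun m => aF n m (ltnSn n))
    (fun m => av n m (ltnSn n)) aS mS).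
Qed.

End BrownianIncrements.

(** * Adapted random matrices *)
Section AdaptedMatrices.
Context (R : realType) (disp : measure_display) (Omega : measurableType disp).
Variables (G : set (set Omega)) (sG : sigma_algebra setT G).

Definition adapted_mx (p q : nat) (A : Omega -> 'M[R]_(p, q)) : Prop :=
  forall i j, adapted G (fun w => A w i j).

Lemma adapted_mx_cst p q (A : 'M[R]_(p, q)) : adapted_mx (fun=> A).
Proof. by move=> i j; exact: adapted_cst. Qed.

Lemma adapted_mxD p q (A B : Omega -> 'M[R]_(p, q)) :
  adapted_mx A -> adapted_mx B -> adapted_mx (fun w => A w + B w).
Proof.
move=> aA aB i j; under [X in adapted _ X]funext do rewrite mxE.
exact: adaptedD.
Qed.

Lemma adapted_mxZ p q (c : R) (A : Omega -> 'M[R]_(p, q)) :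
  adapted_mx A -> adapted_mx (fun w => c *: A w).
Proof.
move=> aA i j; under [X in adapted _ X]funext do rewrite mxE.
by apply: adaptedM => //; exact: adapted_cst.
Qed.

Lemma adapted_mxM p q r (A : Omega -> 'M[R]_(p, q)) (B : Omega -> 'M[R]_(q, r)) :
  adapted_mx A -> adapted_mx B -> adapted_mx (fun w => A w *m B w).
Proof.
move=> aA aB i j; under [X in adapted _ X]funext do rewrite mxE.
by apply: adapted_sum => // k _; exact: adaptedM.
Qed.

Lemma adapted_mx_sum p q (I : eqType) (r : seq I)
    (A : I -> Omega -> 'M[R]_(p, q)) :
  (forall i, i \in r -> adapted_mx (A i)) ->
  adapted_mx (fun w => \sum_(i <- r) A i w).
Proof.
move=> aA i j; under [X in adapted _ X]funext do rewrite summxE.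
by apply: adapted_sum => // k kr; exact: aA.
Qed.

Lemma adapted_mxB p q (A B : Omega -> 'M[R]_(p, q)) :
  adapted_mx A -> adapted_mx B -> adapted_mx (fun w => A w - B w).
Proof.
move=> aA aB; under [X in adapted_mx X]funext do rewrite -scaleN1r.
exact: adapted_mxD (adapted_mxZ _ aB).
Qed.

End AdaptedMatrices.

Lemma adapted_mx_sub (R : realType) disp (Omega : measurableType disp)
    (G G' : set (set Omega)) p q (A : Omega -> 'M[R]_(p, q)) :
  G `<=` G' -> adapted_mx G A -> adapted_mx G' A.
Proof. by move=> GG' aA i j; exact: adapted_sub GG' (aA i j). Qed.

Lemma adapted_mx_sqr_euclid_norm (R : realType) disp
    (Omega : measurableType disp) (G : set (set Omega)) (d : nat)
    (Y : Omega -> 'cV[R]_d) :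
  G `<=` measurable -> adapted_mx G Y ->
  measurable_fun setT (fun w => euclid_norm (Y w) ^+ 2).
Proof.
move=> Gm aY; under eq_fun do rewrite sqr_euclid_norm.
apply: measurable_sum => i; apply: measurable_funX.
exact: adapted_measurable Gm (aY i 0).
Qed.

Lemma adapted_mx_sqr_frob_norm (R : realType) disp
    (Omega : measurableType disp) (G : set (set Omega)) (d : nat)
    (A : Omega -> 'M[R]_d) :
  G `<=` measurable -> adapted_mx G A ->
  measurable_fun setT (fun w => frob_norm (A w) ^+ 2).
Proof.
move=> Gm aA; under eq_fun do rewrite sqr_frob_norm.
apply: measurable_sum => i; apply: measurable_sum => j; apply: measurable_funX.
exact: adapted_measurable Gm (aA i j).
Qed.

(** * Mean squares of discrete Volterra sums *)
Section VolterraSum.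
Context (R : realType) (d : nat) (disp : measure_display).
Context (Omega : measurableType disp) (P : probability Omega R).
Variables (F : R -> set (set Omega)) (W : R -> Omega -> 'cV[R]_d).
Hypotheses (hF : filtration F) (hW : brownian_motion P F W).
Variables (h : R) (t : nat -> R).
Hypotheses (h0 : 0 < h) (t0 : forall j, 0 <= t j).
Hypothesis tS : forall j, t j.+1 = t j + h.

(** One step of a scheme: H and K are the two kernels read backwards in time,
    beta and s are the coefficients evaluated along the past of the scheme. *)
Definition volterra_sum (n : nat) (H K : nat -> 'M[R]_d)
    (beta : nat -> Omega -> 'cV[R]_d) (s : nat -> Omega -> 'M[R]_d)
    (w : Omega) : 'cV[R]_d :=
  \sum_(0 <= j < n) h *: (H j *m beta j w)
  + \sum_(0 <= j < n) K j *m s j w *m (W (t j.+1) w - W (t j) w).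

(** The difference of two steps splits into the effect of changing the kernels
    along a fixed past and that of changing the past for fixed kernels. *)
Lemma volterra_sum_sub n (H K H' K' : nat -> 'M[R]_d)
    (beta beta' : nat -> Omega -> 'cV[R]_d) (s s' : nat -> Omega -> 'M[R]_d) w :
  volterra_sum n H K beta s w - volterra_sum n H' K' beta' s' w =
  volterra_sum n (H \- H') (K \- K') beta s w +
  volterra_sum n H' K' (fun j w => beta j w - beta' j w)
    (fun j w => s j w - s' j w) w.
Proof.
rewrite /volterra_sum opprD addrACA [RHS]addrACA -!sumrB -!big_split /=.
apply: eq_bigr => j _ /=; congr (_ + _).
  by rewrite mulmxBl mulmxBr !scalerBr addrA subrK.
move: (W _ w - W _ w) => x; rewrite mulmxBl mulmxBr !mulmxBl.
by rewrite addrA subrK.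
Qed.

Variables (n : nat) (H K : nat -> 'M[R]_d).
Variables (beta : nat -> Omega -> 'cV[R]_d) (s : nat -> Omega -> 'M[R]_d).
Hypothesis abeta : forall j, (j < n)%N -> adapted_mx (F (t j)) (beta j).
Hypothesis as_ : forall j, (j < n)%N -> adapted_mx (F (t j)) (s j).

Let t_mono : {homo t : i j / (i <= j)%N >-> i <= j}.
Proof.
apply: homo_leq => //; first by move=> y x z; exact: le_trans.
by move=> j; rewrite tS lerDl ltW.
Qed.

Let drift w := \sum_(0 <= j < n) h *: (H j *m beta j w).
Let diffusion w := \sum_(0 <= j < n) K j *m s j w *m (W (t j.+1) w - W (t j) w).

Let aF j p q (A : Omega -> 'M[R]_(p, q)) : (j <= n)%N ->
  adapted_mx (F (t j)) A -> adapted_mx (F (t n)) A.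
Proof. by move=> jn; apply: adapted_mx_sub; apply: filtration_mono => //; exact: t_mono. Qed.

Let sF := filtration_sigma hF (t0 n).
Let mF := filtration_measurable hF (t0 n).

Let drift_adapted : adapted_mx (F (t n)) drift.
Proof.
apply: adapted_mx_sum => // j; rewrite mem_index_iota => /= jn.
apply: adapted_mxZ => //; apply: adapted_mxM => //; first exact: adapted_mx_cst.
by apply: aF (abeta jn); exact: ltnW.
Qed.

Let diffusion_adapted : adapted_mx (F (t n)) diffusion.
Proof.
apply: adapted_mx_sum => // j; rewrite mem_index_iota => /= jn.
apply: adapted_mxM => //.
  apply: adapted_mxM => //; first exact: adapted_mx_cst.
  by apply: aF (as_ jn); exact: ltnW.
move=> i k; rewrite (ord1 k).
apply: adapted_sub (increment_adapted hF hW i (t0 j) (t_mono (leqnSn j))).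
by apply: filtration_mono => //; exact: t_mono.
Qed.

Lemma volterra_sum_adapted : adapted_mx (F (t n)) (volterra_sum n H K beta s).
Proof. exact: adapted_mxD. Qed.

Variable m : nat -> R.
Hypothesis beta_m : forall j, (j < n)%N ->
  mean_le P (fun w => euclid_norm (beta j w) ^+ 2) (m j).
Hypothesis s_m : forall j, (j < n)%N ->
  mean_le P (fun w => frob_norm (s j w) ^+ 2) (m j).

(** Cauchy-Schwarz over the n terms costs a factor n, and n * h is at most the
    time horizon. *)
Lemma drift_sqr_mean_le : mean_le P (fun w => euclid_norm (drift w) ^+ 2)
  (n%:R * h * (h * \sum_(0 <= j < n) frob_norm (H j) ^+ 2 * m j)).
Proof.
have b : mean_le P (fun w => n%:R * h * (h *
      \sum_(0 <= j < n) frob_norm (H j) ^+ 2 * euclid_norm (beta j w) ^+ 2))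
    (n%:R * h * (h * \sum_(0 <= j < n) frob_norm (H j) ^+ 2 * m j)).
  apply: mean_leZ; first by rewrite mulr_ge0// ltW.
  apply: mean_leZ; first exact: ltW.
  apply: mean_le_sum => j; rewrite mem_index_iota => /= jn.
  by apply: mean_leZ; [exact: sqr_ge0|exact: beta_m].
apply: mean_le_dom b; first exact: adapted_mx_sqr_euclid_norm mF drift_adapted.
move=> w; rewrite sqr_ge0 /=; apply: le_trans (sqr_euclid_norm_sum_le _ _) _.
rewrite size_iota subn0 -mulrA ler_wpM2l// !mulr_sumr; apply: ler_sum => j _.
rewrite sqr_euclid_normZ expr2 -mulrA !ler_wpM2l ?(ltW h0)//.
exact: sqr_euclid_norm_mulmx_le.
Qed.

(** The Ito inequality is applied to each coordinate, each entry of K j *m s j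
    being bounded by the whole Frobenius norm: summing over the d rows and d
    columns produces the factor d ^ 2, the inequality itself one more d. *)
Lemma diffusion_sqr_mean_le : mean_le P (fun w => euclid_norm (diffusion w) ^+ 2)
  (8 * d%:R ^+ 3 * (h * \sum_(0 <= j < n) frob_norm (K j) ^+ 2 * m j)).
Proof.
have KsF j : (j < n)%N -> adapted_mx (F (t j)) (fun w => K j *m s j w).
  move=> jn; have sFj := filtration_sigma hF (t0 j).
  by apply: adapted_mxM; [|exact: adapted_mx_cst|exact: as_].
have b i : mean_le P (fun w => diffusion w i 0 ^+ 2)
    (8 * d%:R ^+ 2 * (h * \sum_(0 <= j < n) frob_norm (K j) ^+ 2 * m j)).
  have [j k jn|j k jn|_] := @ito_sum_bound _ _ _ _ _ _ _ hF hW h t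
      (fun j k w => (K j *m s j w) i k) (fun j _ => frob_norm (K j) ^+ 2 * m j)
      n h0 t0 tS.
  - exact: KsF.
  - apply: mean_le_dom (mean_leZ (sqr_ge0 (frob_norm (K j))) (s_m jn)).
      apply: measurable_funX.
      apply: adapted_measurable (KsF j jn i k); exact: filtration_measurable.
    move=> w; rewrite sqr_ge0 /=; apply: le_trans (sqr_frob_norm_mulmx_le _ _).
    rewrite -(real_normK (num_real _)) lerXn2r ?nnegrE ?frob_norm_ge0//.
    exact: coord_le_frob_norm.
  move=> mb.
  under [X in mean_le _ X]funext do rewrite /diffusion summxE.
  under [X in mean_le _ X]funext do under eq_bigr do rewrite mxE.
  apply: mean_le_mono mb _; rewrite le_eqVlt; apply/orP; left; apply/eqP.
  rewrite !mulr_sumr; apply: eq_bigr => j _.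
  by rewrite sumr_const card_ord -[_ *+ d]mulr_natr; ring.
under [X in mean_le _ X]funext do rewrite sqr_euclid_norm.
apply: mean_le_mono (mean_le_sum (fun i _ => b i)) _.
rewrite sumr_const card_ord -[_ *+ d]mulr_natr le_eqVlt; apply/orP; left.
by apply/eqP; ring.
Qed.

Lemma volterra_sum_sqr_mean_le (T : R) : n%:R * h <= T ->
  mean_le P (fun w => euclid_norm (volterra_sum n H K beta s w) ^+ 2)
    (2 * (T + 8 * d%:R ^+ 3) * (h * \sum_(0 <= j < n)
      (frob_norm (H j) ^+ 2 + frob_norm (K j) ^+ 2) * m j)).
Proof.
move=> nT.
have b := mean_leD (mean_leZ (ler0n R 2) drift_sqr_mean_le)
  (mean_leZ (ler0n R 2) diffusion_sqr_mean_le).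
apply: mean_le_mono.
  apply: mean_le_dom b.
    exact: adapted_mx_sqr_euclid_norm mF volterra_sum_adapted.
  by move=> w; rewrite sqr_ge0 /=; exact: sqr_euclid_normD_le.
have m0 j : (j < n)%N -> 0 <= m j by move=> jn; exact: mean_le_ge0 (beta_m jn).
under [X in _ <= _ * (_ * X)]eq_bigr do rewrite mulrDl.
rewrite big_split /=.
set SH := \sum_(0 <= j < n) frob_norm (H j) ^+ 2 * m j.
set SK := \sum_(0 <= j < n) frob_norm (K j) ^+ 2 * m j.
have SH0 : 0 <= SH.
  rewrite /SH big_nat; apply: sumr_ge0 => j jn.
  by rewrite mulr_ge0 ?sqr_ge0 ?m0.
have SK0 : 0 <= SK.
  rewrite /SK big_nat; apply: sumr_ge0 => j jn.
  by rewrite mulr_ge0 ?sqr_ge0 ?m0.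
have T0 : 0 <= T by apply: le_trans nT; rewrite mulr_ge0// ltW.
have d0 : 0 <= 8 * d%:R ^+ 3 :> R by rewrite mulr_ge0// exprn_ge0.
have hH : 0 <= h * SH by rewrite mulr_ge0// ltW.
have hK : 0 <= h * SK by rewrite mulr_ge0// ltW.
have e1 : n%:R * h * (h * SH) <= T * (h * SH) by exact: ler_wpM2r.
rewrite [h * (SH + SK)]mulrDr.
have lin (e c x y : R) : e <= T * x -> 0 <= T * y -> 0 <= c * x ->
    2 * e + 2 * (c * y) <= 2 * (T + c) * (x + y) by lra.
by apply: lin; [exact: e1|exact: mulr_ge0|exact: mulr_ge0].
Qed.

End VolterraSum.

(** * Riemann sums of monotone kernels *)
Section MonotoneKernels.
Context {R : realType}.
Implicit Types (f : R -> R) (T : R).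

Definition nonincr_on_pos f : Prop := forall x y, 0 < x -> x <= y -> f y <= f x.

Lemma nonincr_on_pos_measurable f (a b : R) : 0 <= a -> nonincr_on_pos f ->
  measurable_fun `]a, b] f.
Proof.
move=> a0 fd; apply: (measurability (@RGenCInfty.G R)) => [|/= _ [_] [r] -> <-].
  exact: RGenCInfty.measurableE.
apply: is_interval_measurable => s t /=.
rewrite !in_itv/= !andbT => -[/andP[as_ _] _] [/andP[_ tb] ft] u /andP[su ut].
have au : a < u by exact: lt_le_trans su.
rewrite !in_itv/= !andbT au (le_trans ut tb); split => //.
by apply: le_trans ft _; apply: fd => //; exact: le_lt_trans au.
Qed.

(** On each cell the value at the right end point is a lower bound of the
    function. This is why monotonicity of the kernels makes the bounds uniform
    in the mesh although the kernels may blow up at 0. *)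
Lemma riemann_sum_le_integral f h (N : nat) : 0 < h -> nonincr_on_pos f ->
  (forall x, 0 < x -> 0 <= f x) ->
  ((h * \sum_(1 <= l < N.+1) f (l%:R * h))%:E <=
   \int[lebesgue_measure]_(x in `]0%R, (N%:R * h)%R]) (f x)%:E)%E.
Proof.
move=> h0 fd f0; elim: N => [|N ih].
  rewrite big_geq// mulr0; apply: integral_ge0 => x /=; rewrite in_itv/=.
  by move=> /andP[x0 _]; rewrite lee_fin f0.
have Nh : N%:R * h <= N.+1%:R * h by rewrite ler_wpM2r ?(ltW h0)// ler_nat.
have Nh0 : 0 <= N%:R * h by rewrite mulr_ge0// ltW.
rewrite (@itv_bndbnd_setU _ _ _ (BRight (N%:R * h))) ?bnd_simp//.
rewrite ge0_integral_setU//=; last 3 first.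
- rewrite -itv_bndbnd_setU ?bnd_simp//; apply/measurable_EFinP.
  exact: nonincr_on_pos_measurable.
- move=> x; rewrite !in_itv/= => xh; rewrite lee_fin f0//.
  by case: xh => /andP[// x0 _]; exact: le_lt_trans x0.
- apply/disj_setPS => x [] /=; rewrite !in_itv/= => /andP[_ xN] /andP[Nx _].
  by move: (lt_le_trans Nx xN); rewrite ltxx.
rewrite big_nat_recr//= mulrDr EFinD leeD//.
have -> : (h * f (N.+1%:R * h))%:E =
    (\int[lebesgue_measure]_(x in `](N%:R * h)%R, (N.+1%:R * h)%R]%classic)
      (cst (f (N.+1%:R * h))%:E x))%E.
  rewrite integral_cst//= lebesgue_measure_itv/= lte_fin.
  rewrite ltr_pM2r// ltr_nat ltnSn -EFinD -EFinM; congr EFin.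
  by rewrite -mulrBl -natrB// subSnn mul1r mulrC.
apply: ge0_le_integral => //=.
- by move=> x _; rewrite lee_fin f0// mulr_gt0.
- by apply/measurable_EFinP; exact: nonincr_on_pos_measurable.
- move=> x; rewrite in_itv/= => /andP[Nx xN]; rewrite lee_fin fd//.
  exact: le_lt_trans Nx.
Qed.

(** The integral of f x * e ^ (- n x) tends to 0 with 1 / n by dominated
    convergence, and it dominates all the Riemann sums at once because the
    weight keeps f nonincreasing. *)
Lemma exponential_weight_small f T (e : R) : 0 < T -> 0 < e ->
  nonincr_on_pos f -> (forall x, 0 < x -> 0 <= f x) ->
  (\int[lebesgue_measure]_(x in `]0%R, T]) (f x)%:E < +oo)%E ->
  exists n : nat, forall N : nat, (0 < N)%N ->
    T / N%:R * \sum_(1 <= l < N.+1)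
      f (l%:R * (T / N%:R)) * expR (- n%:R * (l%:R * (T / N%:R))) <= e.
Proof.
move=> T0 e0 fd f0 fT.
pose g (n : nat) x := f x * expR (- n%:R * x).
have gd n : nonincr_on_pos (g n).
  move=> x y x0 xy; rewrite /g; apply: ler_pM; rewrite ?f0 ?expR_ge0//.
  - exact: lt_le_trans xy.
  - exact: fd.
  - by rewrite ler_expR !mulNr lerN2 ler_wpM2l.
have g0 n x : 0 < x -> 0 <= g n x by move=> x0; rewrite mulr_ge0 ?f0 ?expR_ge0.
have mf : measurable_fun `]0, T] (EFin \o f).
  by apply/measurable_EFinP; exact: nonincr_on_pos_measurable.
have mg n : measurable_fun `]0, T] (EFin \o g n).
  by apply/measurable_EFinP; exact: nonincr_on_pos_measurable.
have intf : lebesgue_measure.-integrable `]0, T] (EFin \o f).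
  apply/integrableP; split => //.
  apply: le_lt_trans fT; rewrite le_eqVlt; apply/orP; left; apply/eqP.
  apply: eq_integral => x; rewrite inE/= in_itv/= => /andP[x0 _].
  by rewrite ger0_norm ?f0.
have gcvg x : `]0, T]%classic x -> (g n x)%:E @[n --> \oo] --> 0%E.
  rewrite /= in_itv/= => /andP[x0 _].
  apply/fine_cvgP; split; first exact: nearW.
  have -> : fine \o (fun n => (g n x)%:E) = (fun n => f x * expR (- x) ^+ n).
    apply/funext => n /=; rewrite /g -expRM_natr; congr (_ * expR _).
    by rewrite mulrC mulNr mulrN mulrC.
  rewrite -(mulr0 (f x)); apply: cvgM; first exact: cvg_cst.
  apply: cvg_expr.
  by rewrite ger0_norm ?expR_ge0// expR_lt1 oppr_lt0.
have gle x n : `]0, T]%classic x -> (`|(g n x)%:E| <= (EFin \o f) x)%E.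
  rewrite /= in_itv/= => /andP[x0 _].
  rewrite lee_fin ger0_norm ?g0// ler_piMr ?f0// -expR0 ler_expR.
  by rewrite mulNr oppr_le0 mulr_ge0// ltW.
have [||_ _] := @dominated_convergence _ _ _ lebesgue_measure `]0, T]%classic
  (measurable_itv _) (fun n x => (g n x)%:E) (cst 0%E) (EFin \o f)
  mg (measurable_cst _) _ intf _.
- by apply: aeW; exact: gcvg.
- by apply: aeW => x n; exact: gle.
rewrite integral0 => cv.
have /cv[n _ /(_ n (leqnn n)) /= nint] : nbhs (0 : \bar R)%E (fun u => u < e%:E)%E.
  by apply: open_ereal_lt'; rewrite lte_fin.
exists n => N N0.
have Th : N%:R * (T / N%:R) = T.
  by rewrite mulrC divfK// pnatr_eq0 -lt0n.
have h0 : 0 < T / N%:R by rewrite divr_gt0// ltr0n.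
have := riemann_sum_le_integral N h0 (gd n) (g0 n); rewrite Th => h.
by rewrite -lee_fin; apply: le_trans h (ltW nint).
Qed.

End MonotoneKernels.

(** * A discrete Volterra Gronwall inequality *)
(** If the weighted kernel has mass at most 1/2, the bound
    2 A e ^ (theta t) reproduces itself through the recursion. The predicate
    U k m stands for the assertion that the k-th quantity is at most m: this
    form needs no finiteness of that quantity beforehand, which is instead part
    of the conclusion. *)
Lemma volterra_gronwall (R : realType) (U : nat -> R -> Prop) (q : R -> R)
    (A h theta : R) (N : nat) :
  0 < h -> 0 <= A -> 0 <= theta ->
  (forall x, 0 < x -> 0 <= q x) ->
  h * \sum_(1 <= l < N.+1) q (l%:R * h) * expR (- theta * (l%:R * h)) <= 1 / 2 ->
  (forall k x y, U k x -> x <= y -> U k y) ->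
  U 0%N A ->
  (forall k, (k < N)%N -> forall v : nat -> R,
    (forall j, (j <= k)%N -> U j (v j)) ->
    U k.+1 (A + h * \sum_(0 <= j < k.+1) q ((k.+1 - j)%:R * h) * v j)) ->
  forall k, (k <= N)%N -> U k (2 * A * expR (theta * (k%:R * h))).
Proof.
move=> h0 A0 th0 q0 hq Umono U0 Urec.
elim/ltn_ind => -[_ _|k ih kN].
  apply: Umono U0 _; rewrite mul0r mulr0 expR0; lra.
apply: Umono.
  apply: (Urec k kN (fun j => 2 * A * expR (theta * (j%:R * h)))) => j jk.
  by apply: ih => //; exact: leq_trans jk (ltnW kN).
set e := expR (theta * (k.+1%:R * h)).
have e1 : 1 <= e by rewrite -expR0 ler_expR !mulr_ge0 ?(ltW h0).
have -> : h * \sum_(0 <= j < k.+1)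
      q ((k.+1 - j)%:R * h) * (2 * A * expR (theta * (j%:R * h))) =
    2 * A * e *
    (h * \sum_(1 <= l < k.+2) q (l%:R * h) * expR (- theta * (l%:R * h))).
  rewrite big_add1 /= big_nat_rev /= add0n mulrCA; congr (_ * _).
  rewrite mulr_sumr; apply: eq_big_nat => j /= jk.
  rewrite subSS subSn ?leq_subr// subKn//.
  have -> : e = expR (theta * (j.+1%:R * h)) * expR (theta * ((k - j)%:R * h)).
    rewrite -expRD /e; congr expR.
    by rewrite -mulrDr -mulrDl -natrD addSn subnKC.
  rewrite mulNr expRN.
  have : expR (theta * (j.+1%:R * h)) != 0 by rewrite gt_eqF// expR_gt0.
  by move: (expR _) (expR _) => a c a0; field.
have hk : h * \sum_(1 <= l < k.+2) q (l%:R * h) * expR (- theta * (l%:R * h)) <= 1 / 2.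
  apply: le_trans hq; rewrite ler_wpM2l ?(ltW h0)//.
  rewrite [leRHS](big_cat_nat _ (n := k.+2))//= lerDl.
  rewrite big_nat; apply: sumr_ge0 => l /andP[kl _].
  by rewrite mulr_ge0 ?expR_ge0// q0// mulr_gt0// ltr0n (leq_trans _ kl).
have Ae : 0 <= A * e by rewrite mulr_ge0// (le_trans _ e1).
have : A <= A * e by rewrite ler_peMr.
move: (h * _) hk => S hS; nra.
Qed.

(** * Kernels given by Laplace transforms *)
Section LaplaceKernels.
Context (R : realType) (d : nat).
Variable lambda : {measure set (measurableTypeR R) -> \bar R}.
Hypothesis hlambda : admissible_measure lambda.

Definition gbar (t : R) : R := fine (Gbar lambda t).

Let Gbar_ge0 t : (0 <= Gbar lambda t)%E.
Proof. by apply: integral_ge0 => x _; rewrite lee_fin expR_ge0. Qed.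

Let gbarE t : 0 < t -> ((gbar t)%:E = Gbar lambda t)%E.
Proof.
move=> t0; rewrite fineK// ge0_fin_numE//.
by have [h _] := hlambda; exact: h.
Qed.

Lemma gbar_ge0 t : 0 <= gbar t.
Proof. exact: fine_ge0. Qed.

Let mexp t : measurable_fun setT (fun rho : measurableTypeR R => expR (- rho * t)).
Proof.
apply: measurableT_comp; first exact: measurable_expR.
by apply: measurable_funM => //; exact: oppr_measurable.
Qed.

Lemma gbar_nonincr : nonincr_on_pos gbar.
Proof.
move=> x y x0 xy; rewrite -lee_fin !gbarE//; last exact: lt_le_trans xy.
rewrite /Gbar; apply: ge0_le_integral => //.
- by apply/measurable_EFinP; exact: measurable_funTS.
- by apply/measurable_EFinP; exact: measurable_funTS.
- move=> r; rewrite /= in_itv/= andbT => r0.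
  by rewrite lee_fin ler_expR !mulNr lerN2 ler_wpM2l.
Qed.

(** The integrand is dominated by K e ^ (- rho t). *)
Lemma laplace_kernel_coord_le (M : R -> 'M[R]_d) (K t : R) i j :
  measurable_mx `[0, +oo[ M -> (forall rho, 0 <= rho -> frob_norm (M rho) <= K) ->
  0 < t -> `|laplace_kernel lambda M t i j| <= K * gbar t.
Proof.
move=> mM MK t0; rewrite mxE.
have K0 : 0 <= K by exact: le_trans (frob_norm_ge0 _) (MK 0 (lexx _)).
have mf : measurable_fun (`[0, +oo[%classic : set (measurableTypeR R))
    (fun rho => expR (- rho * t) * M rho i j).
  by apply: measurable_funM; [exact: measurable_funTS|exact: mM].
have le x : `[0, +oo[%classic x ->
    `|expR (- x * t) * M x i j| <= K * expR (- x * t).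
  rewrite /= in_itv/= andbT => x0.
  rewrite normrM ger0_norm ?expR_ge0// mulrC ler_wpM2r ?expR_ge0//.
  exact: le_trans (coord_le_frob_norm _ _ _) (MK _ x0).
have mg : measurable_fun (`[0, +oo[%classic : set (measurableTypeR R))
    (fun rho => (K * expR (- rho * t))%:E).
  by apply/measurable_EFinP; apply: measurable_funM => //; exact: measurable_funTS.
have eg : (\int[lambda]_(x in `[0%R, +oo[) (K * expR (- x * t))%:E =
    (K * gbar t)%:E)%E.
  rewrite EFinM gbarE// /Gbar -ge0_integralZl//.
  by apply/measurable_EFinP; exact: measurable_funTS.
have lef : (\int[lambda]_(x in `[0%R, +oo[) `|(expR (- x * t) * M x i j)%:E| <=
    (K * gbar t)%:E)%E.
  rewrite -eg; apply: ge0_le_integral => //.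
  by apply: measurableT_comp => //; exact/measurable_EFinP.
have intf : lambda.-integrable (`[0, +oo[%classic : set (measurableTypeR R))
    (EFin \o (fun rho => expR (- rho * t) * M rho i j)).
  apply/integrableP; split; first exact/measurable_EFinP.
  by apply: le_lt_trans lef _; rewrite ltry.
apply: (le_trans (le_normr_Rintegral _ intf)) => //.
rewrite -lee_fin; apply: le_trans lef.
rewrite /Rintegral fineK//; apply: integrable_fin_num => //.
exact: (integrable_norm intf).
Qed.

Lemma sqr_frob_laplace_kernel_le (M : R -> 'M[R]_d) (K t : R) :
  measurable_mx `[0, +oo[ M -> (forall rho, 0 <= rho -> frob_norm (M rho) <= K) ->
  0 < t -> frob_norm (laplace_kernel lambda M t) ^+ 2 <=
           (d%:R * K) ^+ 2 * gbar t ^+ 2.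
Proof.
move=> mM MK t0; rewrite sqr_frob_norm.
have K0 : 0 <= K by exact: le_trans (frob_norm_ge0 _) (MK 0 (lexx _)).
have -> : (d%:R * K) ^+ 2 * gbar t ^+ 2 =
    \sum_(i < d) \sum_(j < d) (K * gbar t) ^+ 2.
  by rewrite !sumr_const card_ord -[_ *+ d *+ d]mulr_natr -[_ *+ d]mulr_natr; ring.
apply: ler_sum => i _; apply: ler_sum => j _.
rewrite -(real_normK (num_real _)) lerXn2r ?nnegrE ?mulr_ge0 ?gbar_ge0//.
exact: laplace_kernel_coord_le.
Qed.

(** A scalar nonincreasing function, integrable near 0, above the squared norms
    of all the kernels: the kernels themselves are not monotone. *)
Definition kernel_majorant (c t : R) : R := c * (1 + gbar t ^+ 2).

Lemma kernel_majorant_ge0 c t : 0 <= c -> 0 <= kernel_majorant c t.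
Proof. by move=> c0; rewrite mulr_ge0// addr_ge0// sqr_ge0. Qed.

Lemma kernel_majorant_nonincr c : 0 <= c -> nonincr_on_pos (kernel_majorant c).
Proof.
move=> c0 x y x0 xy; rewrite /kernel_majorant ler_wpM2l// lerD2l.
by rewrite lerXn2r ?nnegrE ?gbar_ge0//; exact: gbar_nonincr.
Qed.

Lemma kernel_majorant_integral_lty c T : 0 <= c -> 0 < T ->
  (\int[lebesgue_measure]_(t in `]0%R, T]) (kernel_majorant c t)%:E < +oo)%E.
Proof.
move=> c0 T0.
have gd : nonincr_on_pos (fun t => gbar t ^+ 2).
  move=> x y x0 xy.
  by rewrite lerXn2r ?nnegrE ?gbar_ge0//; exact: gbar_nonincr.
have mg : measurable_fun `]0, T] (fun t => (gbar t ^+ 2)%:E).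
  by apply/measurable_EFinP; exact: nonincr_on_pos_measurable.
under eq_integral do rewrite /kernel_majorant EFinM EFinD.
rewrite ge0_integralZl//; last 2 first.
- exact: emeasurable_funD.
- by move=> t _; rewrite -EFinD lee_fin addr_ge0 ?sqr_ge0.
apply: lte_mul_pinfty => //.
rewrite ge0_integralD//; last by move=> t _; rewrite lee_fin sqr_ge0.
rewrite lte_add_pinfty//.
  by rewrite integral_cst//= lebesgue_measure_itv/= lte_fin T0 -EFinD -EFinM ltry.
have [_ /(_ T T0)] := hlambda; congr (_ < _)%E.
apply: eq_integral => t; rewrite inE/= in_itv/= => /andP[t0 _].
by rewrite -gbarE// EFin_expe.
Qed.

End LaplaceKernels.

(** * Globally Lipschitz coefficients *)
Section LipschitzCoefficients.
Context (R : realType) (d : nat).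
Variables (b : 'cV[R]_d -> 'cV[R]_d) (sigma : 'cV[R]_d -> 'M[R]_d) (L : R).
Hypothesis hL : forall x y,
  euclid_norm (b x - b y) + frob_norm (sigma x - sigma y) <= L * euclid_norm (x - y).

Lemma lipschitz_drift x y : euclid_norm (b x - b y) <= L * euclid_norm (x - y).
Proof. by apply: le_trans (hL x y); rewrite lerDl frob_norm_ge0. Qed.

Lemma lipschitz_diffusion x y :
  frob_norm (sigma x - sigma y) <= L * euclid_norm (x - y).
Proof. by apply: le_trans (hL x y); rewrite lerDr euclid_norm_ge0. Qed.

Lemma sqr_lipschitz_drift x y :
  euclid_norm (b x - b y) ^+ 2 <= L ^+ 2 * euclid_norm (x - y) ^+ 2.
Proof.
have h := lipschitz_drift x y; rewrite -exprMn lerXn2r ?nnegrE ?euclid_norm_ge0//.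
exact: le_trans (euclid_norm_ge0 _) h.
Qed.

Lemma sqr_lipschitz_diffusion x y :
  frob_norm (sigma x - sigma y) ^+ 2 <= L ^+ 2 * euclid_norm (x - y) ^+ 2.
Proof.
have h := lipschitz_diffusion x y; rewrite -exprMn lerXn2r ?nnegrE ?frob_norm_ge0//.
exact: le_trans (frob_norm_ge0 _) h.
Qed.

(** The constant also dominates L ^ 2, so that the moment bound and the error
    bound can share one Gronwall kernel. *)
Definition growth_cst : R :=
  2 * (euclid_norm (b 0) ^+ 2 + frob_norm (sigma 0) ^+ 2 + L ^+ 2).

Lemma growth_cst_ge0 : 0 <= growth_cst.
Proof. by rewrite mulr_ge0// !addr_ge0// sqr_ge0. Qed.

Lemma sqr_lipschitz_le_growth : L ^+ 2 <= growth_cst.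
Proof.
rewrite /growth_cst; have := sqr_ge0 (euclid_norm (b 0)).
by have := sqr_ge0 (frob_norm (sigma 0)); have := sqr_ge0 L; lra.
Qed.

Lemma drift_growth x : euclid_norm (b x) ^+ 2 <= growth_cst * (1 + euclid_norm x ^+ 2).
Proof.
have h := sqr_euclid_normD_le (b x - b 0) (b 0); rewrite subrK in h.
have := sqr_lipschitz_drift x 0; rewrite subr0 => h'.
apply: le_trans h _; rewrite /growth_cst.
move: h' (sqr_ge0 (euclid_norm (b 0))) (sqr_ge0 (frob_norm (sigma 0)))
  (sqr_ge0 L) (sqr_ge0 (euclid_norm x)).
move: (euclid_norm (b x - b 0) ^+ 2) (euclid_norm (b 0) ^+ 2)
  (frob_norm (sigma 0) ^+ 2) (L ^+ 2) (euclid_norm x ^+ 2) => u v s l z h1 h2 h3 h4 h5.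
by have := mulr_ge0 h2 h5; have := mulr_ge0 h3 h5; lra.
Qed.

Lemma diffusion_growth x :
  frob_norm (sigma x) ^+ 2 <= growth_cst * (1 + euclid_norm x ^+ 2).
Proof.
have h := sqr_frob_normD_le (sigma x - sigma 0) (sigma 0); rewrite subrK in h.
have := sqr_lipschitz_diffusion x 0; rewrite subr0 => h'.
apply: le_trans h _; rewrite /growth_cst.
move: h' (sqr_ge0 (euclid_norm (b 0))) (sqr_ge0 (frob_norm (sigma 0)))
  (sqr_ge0 L) (sqr_ge0 (euclid_norm x)).
move: (frob_norm (sigma x - sigma 0) ^+ 2) (euclid_norm (b 0) ^+ 2)
  (frob_norm (sigma 0) ^+ 2) (L ^+ 2) (euclid_norm x ^+ 2) => u v s l z h1 h2 h3 h4 h5.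
by have := mulr_ge0 h2 h5; have := mulr_ge0 h3 h5; lra.
Qed.

Context (disp : measure_display) (Omega : measurableType disp).
Variables (G : set (set Omega)) (sG : sigma_algebra setT G).

Lemma adapted_drift (Y : Omega -> 'cV[R]_d) : adapted_mx G Y ->
  adapted_mx G (fun w => b (Y w)).
Proof.
move=> aY i j; rewrite (ord1 j).
apply: (@adapted_lipschitz_comp _ _ _ _ _ (fun x => b x i 0) L) => //.
move=> x y; apply: le_trans (lipschitz_drift x y).
by have := coord_le_euclid_norm (b x - b y) i; rewrite !mxE.
Qed.

Lemma adapted_diffusion (Y : Omega -> 'cV[R]_d) : adapted_mx G Y ->
  adapted_mx G (fun w => sigma (Y w)).
Proof.
move=> aY i j.
apply: (@adapted_lipschitz_comp _ _ _ _ _ (fun x => sigma x i j) L) => //.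
move=> x y; apply: le_trans (lipschitz_diffusion x y).
by have := coord_le_frob_norm (sigma x - sigma y) i j; rewrite !mxE.
Qed.

End LipschitzCoefficients.

(** * Moments and difference of two Volterra Euler schemes *)
Section EulerSchemes.
Context (R : realType) (d : nat).
Variables (x0 : 'cV[R]_d).
Variables (b : 'cV[R]_d -> 'cV[R]_d) (sigma : 'cV[R]_d -> 'M[R]_d) (L : R).
Hypothesis hL : forall x y,
  euclid_norm (b x - b y) + frob_norm (sigma x - sigma y) <= L * euclid_norm (x - y).
Context (disp : measure_display).
Context (Omega : measurableType disp) (P : probability Omega R).
Variables (F : R -> set (set Omega)) (W : R -> Omega -> 'cV[R]_d).
Hypotheses (hF : filtration F) (hW : brownian_motion P F W).
Variables (T : R) (N : nat).
Hypotheses (T0 : 0 < T) (N0 : (0 < N)%N).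

Let h := T / N%:R.
Let t := grid T N.
Let c := growth_cst b sigma L.
Let kappa := 2 * (T + 8 * d%:R ^+ 3).

Lemma gridE k : grid T N k = k%:R * (T / N%:R).
Proof. by rewrite /grid mulrA. Qed.

Let h0 : 0 < h. Proof. by rewrite divr_gt0// ltr0n. Qed.

Let t0 j : 0 <= t j.
Proof. by rewrite /t gridE mulr_ge0// ltW. Qed.

Let tS j : t j.+1 = t j + h.
Proof. by rewrite /t !gridE -natr1 mulrDl mul1r. Qed.

Let Nh k : (k <= N)%N -> k%:R * h <= T.
Proof.
move=> kN; have TE : N%:R * h = T by rewrite /h mulrC divfK// pnatr_eq0 -lt0n.
by rewrite -[leRHS]TE ler_wpM2r ?(ltW h0)// ler_nat.
Qed.

Let kappa0 : 0 <= kappa.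
Proof. by rewrite mulr_ge0// addr_ge0 ?(ltW T0)// mulr_ge0// exprn_ge0. Qed.

Let c0 : 0 <= c. Proof. exact: growth_cst_ge0. Qed.

Lemma volterra_euler_step (G1 G2 : R -> 'M[R]_d) (X : nat -> Omega -> 'cV[R]_d) :
  volterra_euler x0 T b sigma W G1 G2 N X ->
  forall k, (k < N)%N -> X k.+1 = (fun w => x0 + volterra_sum W h t k.+1
    (fun j => G1 (t (k.+1 - j)%N)) (fun j => G2 (t (k.+1 - j)%N))
    (fun j w => b (X j w)) (fun j w => sigma (X j w)) w).
Proof.
by move=> [_ hX] k kN; apply/funext => w; rewrite hX// -addrA.
Qed.

Lemma volterra_euler_adapted (G1 G2 : R -> 'M[R]_d) (X : nat -> Omega -> 'cV[R]_d) :
  volterra_euler x0 T b sigma W G1 G2 N X ->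
  forall k, (k <= N)%N -> adapted_mx (F (t k)) (X k).
Proof.
move=> hX; elim/ltn_ind => -[_ _|k ih kN].
  have -> : X 0%N = fun=> x0 by apply/funext => w; case: hX => ->.
  by apply: adapted_mx_cst; exact: filtration_sigma.
rewrite (volterra_euler_step hX)//; have sF := filtration_sigma hF (t0 k.+1).
apply: adapted_mxD => //; first exact: adapted_mx_cst.
apply: (volterra_sum_adapted hF hW h0 t0 tS) => j jk;
  have sFj := filtration_sigma hF (t0 j).
- by apply: (adapted_drift hL) => //; apply: ih => //; exact: leq_trans (ltnW jk) kN.
- by apply: (adapted_diffusion hL) => //; apply: ih => //; exact: leq_trans (ltnW jk) kN.
Qed.

Variable Q : R -> R.
Hypothesis Q0 : forall x, 0 < x -> 0 <= Q x.

Let tpos k j : (j < k)%N -> 0 < t (k - j)%N.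
Proof. by move=> jk; rewrite /t gridE mulr_gt0// ltr0n subn_gt0. Qed.

Let sum_rev (f : nat -> R) k :
  \sum_(0 <= j < k.+1) f (k.+1 - j)%N = \sum_(1 <= l < k.+2) f l.
Proof.
rewrite [RHS]big_add1 /= [LHS]big_nat_rev /= add0n.
by apply: eq_big_nat => j /= jk; rewrite subSS subSn ?leq_subr// subKn.
Qed.

Let sum_widen (f : nat -> R) k : (k < N)%N -> (forall l, (0 < l)%N -> 0 <= f l) ->
  \sum_(1 <= l < k.+2) f l <= \sum_(1 <= l < N.+1) f l.
Proof.
move=> kN f0; rewrite [leRHS](big_cat_nat _ (n := k.+2))//= lerDl.
rewrite big_nat; apply: sumr_ge0 => l /andP[kl _].
by apply: f0; exact: leq_trans kl.
Qed.

Lemma volterra_sum_majorized (G1 G2 : R -> 'M[R]_d) (k : nat)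
    (beta : nat -> Omega -> 'cV[R]_d) (s : nat -> Omega -> 'M[R]_d) (m : nat -> R) :
  (forall x, 0 < x -> x <= T -> frob_norm (G1 x) ^+ 2 <= Q x) ->
  (forall x, 0 < x -> x <= T -> frob_norm (G2 x) ^+ 2 <= Q x) ->
  (k < N)%N ->
  (forall j, (j < k.+1)%N -> adapted_mx (F (t j)) (beta j)) ->
  (forall j, (j < k.+1)%N -> adapted_mx (F (t j)) (s j)) ->
  (forall j, (j < k.+1)%N -> mean_le P (fun w => euclid_norm (beta j w) ^+ 2) (m j)) ->
  (forall j, (j < k.+1)%N -> mean_le P (fun w => frob_norm (s j w) ^+ 2) (m j)) ->
  mean_le P (fun w => euclid_norm (volterra_sum W h t k.+1
    (fun j => G1 (t (k.+1 - j)%N)) (fun j => G2 (t (k.+1 - j)%N)) beta s w) ^+ 2)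
    (2 * kappa * (h * \sum_(0 <= j < k.+1) Q (t (k.+1 - j)%N) * m j)).
Proof.
move=> G1Q G2Q kN abeta as_ mbeta ms.
apply: mean_le_mono (volterra_sum_sqr_mean_le hF hW h0 t0 tS _ _ abeta as_ mbeta ms (Nh kN)) _.
rewrite -/kappa [2 * kappa]mulrC -[leRHS]mulrA ler_wpM2l//.
rewrite mulrCA ler_wpM2l ?(ltW h0)// mulr_sumr big_nat [leRHS]big_nat.
apply: ler_sum => j /= jk; rewrite mulrA ler_wpM2r ?(mean_le_ge0 (mbeta j jk))//.
have tj : t (k.+1 - j)%N <= T.
  by rewrite /t gridE; apply: Nh; exact: leq_trans (leq_subr _ _) kN.
by rewrite mulr2n mulrDl mul1r lerD// ?G1Q ?G2Q// tpos.
Qed.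

(** The mean squares of a scheme satisfy a linear Volterra inequality with
    kernel 4 kappa c Q: one factor 2 comes from the square of x0 + V, the other
    from the two kernels below Q. The constant term collects x0 and the constant
    part of the growth bound. *)
Lemma volterra_euler_moment (G1 G2 : R -> 'M[R]_d) (X : nat -> Omega -> 'cV[R]_d)
    (I theta : R) :
  volterra_euler x0 T b sigma W G1 G2 N X ->
  (forall x, 0 < x -> x <= T -> frob_norm (G1 x) ^+ 2 <= Q x) ->
  (forall x, 0 < x -> x <= T -> frob_norm (G2 x) ^+ 2 <= Q x) ->
  h * \sum_(1 <= l < N.+1) Q (t l) <= I -> 0 <= theta ->
  h * \sum_(1 <= l < N.+1)
    (4 * kappa * c * Q (l%:R * h)) * expR (- theta * (l%:R * h)) <= 1 / 2 ->
  forall k, (k <= N)%N -> mean_le P (fun w => euclid_norm (X k w) ^+ 2)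
    (2 * (2 * euclid_norm x0 ^+ 2 + 4 * kappa * c * I) * expR (theta * T)).
Proof.
move=> hX G1Q G2Q hI th0 hth k kN.
pose A := 2 * euclid_norm x0 ^+ 2 + 4 * kappa * c * I.
have I0 : 0 <= I.
  apply: le_trans hI; rewrite mulr_ge0 ?(ltW h0)// big_nat; apply: sumr_ge0.
  by move=> l /andP[l0 _]; apply: Q0; rewrite /t gridE mulr_gt0// ltr0n.
have kc0 : 0 <= 4 * kappa * c by apply: mulr_ge0 => //; apply: mulr_ge0.
have A0 : 0 <= A by rewrite /A addr_ge0// mulr_ge0// sqr_ge0.
pose U j m := mean_le P (fun w => euclid_norm (X j w) ^+ 2) m.
have : U k (2 * A * expR (theta * (k%:R * h))).
  apply: (@volterra_gronwall R U (fun x => 4 * kappa * c * Q x) A h theta N) => //.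
  - by move=> x x0_; rewrite mulr_ge0// Q0.
  - by move=> j x y; exact: mean_le_mono.
  - have -> : U 0%N A = mean_le P (fun=> euclid_norm x0 ^+ 2) A.
      by congr (mean_le P _ A); apply/funext => w; case: hX => ->.
    apply: mean_le_mono (mean_le_cst P (sqr_ge0 _)) _.
    by rewrite /A; have := sqr_ge0 (euclid_norm x0); have := mulr_ge0 kc0 I0; lra.
  move=> {}k {}kN v vU.
  have aX j : (j < k.+1)%N -> adapted_mx (F (t j)) (X j).
    by move=> jk; apply: (volterra_euler_adapted hX); exact: leq_trans (ltnW jk) kN.
  have v0 j : (j < k.+1)%N -> 0 <= v j by move=> /vU; exact: mean_le_ge0.
  have vc j : (j < k.+1)%N ->
      mean_le P (fun w => c * (1 + euclid_norm (X j w) ^+ 2)) (c * (1 + v j)).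
    move=> jk; apply: mean_leZ => //; apply: mean_leD; first exact: mean_le_cst.
    exact: vU.
  have mF j := filtration_measurable hF (t0 j).
  have sF j := filtration_sigma hF (t0 j).
  have V := volterra_sum_majorized G1Q G2Q kN
    (fun j jk => adapted_drift hL (sF j) (aX j jk))
    (fun j jk => adapted_diffusion hL (sF j) (aX j jk))
    (fun j jk => mean_le_dom (adapted_mx_sqr_euclid_norm (@mF j)
        (adapted_drift hL (sF j) (aX j jk)))
      (fun w => introT andP (conj (sqr_ge0 _) (drift_growth hL (X j w)))) (vc j jk))
    (fun j jk => mean_le_dom (adapted_mx_sqr_frob_norm (@mF j)
        (adapted_diffusion hL (sF j) (aX j jk)))
      (fun w => introT andP (conj (sqr_ge0 _) (diffusion_growth hL (X j w)))) (vc j jk)).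
  have mX : measurable_fun setT (fun w => euclid_norm (X k.+1 w) ^+ 2).
    exact: adapted_mx_sqr_euclid_norm (@mF k.+1) (volterra_euler_adapted hX kN).
  have x0m := mean_le_cst P (mulr_ge0 (ler0n R 2) (sqr_ge0 (euclid_norm x0))).
  rewrite /U; apply: mean_le_mono.
    apply: mean_le_dom (mean_leD x0m (mean_leZ (ler0n R 2) V)) => // w.
    by rewrite sqr_ge0 (volterra_euler_step hX kN); exact: sqr_euclid_normD_le.
  have -> : \sum_(0 <= j < k.+1) Q (t (k.+1 - j)%N) * (c * (1 + v j)) =
      c * (\sum_(0 <= j < k.+1) Q (t (k.+1 - j)%N) +
           \sum_(0 <= j < k.+1) Q (t (k.+1 - j)%N) * v j).
    by rewrite -big_split mulr_sumr; apply: eq_bigr => j _ /=; ring.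
  have -> : \sum_(0 <= j < k.+1) 4 * kappa * c * Q ((k.+1 - j)%:R * h) * v j =
      4 * kappa * c * \sum_(0 <= j < k.+1) Q (t (k.+1 - j)%N) * v j.
    by rewrite mulr_sumr; apply: eq_bigr => j _; rewrite /t gridE mulrA.
  have SQ : h * \sum_(0 <= j < k.+1) Q (t (k.+1 - j)%N) <= I.
    apply: le_trans hI; rewrite ler_wpM2l ?(ltW h0)//.
    rewrite (sum_rev (fun l => Q (t l))); apply: (sum_widen (f := fun l => Q (t l))) => //.
    by move=> l l0; apply: Q0; rewrite /t gridE mulr_gt0// ltr0n.
  have := ler_wpM2l kc0 SQ; rewrite /A; lra.
rewrite -/A => h1; apply: mean_le_mono h1 _; apply: ler_wpM2l; first by rewrite mulr_ge0.
rewrite ler_expR; apply: ler_wpM2l => //; exact: Nh.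
Qed.

(** Changing the kernels along Xh costs at most the kernel error times
    c (1 + B); changing Xh into X along fixed kernels is controlled by the past
    errors through the Lipschitz bound. Gronwall absorbs the second part. *)
Lemma volterra_euler_error (G1 G2 Gh1 Gh2 : R -> 'M[R]_d)
    (X Xh : nat -> Omega -> 'cV[R]_d) (B theta : R) :
  volterra_euler x0 T b sigma W G1 G2 N X ->
  volterra_euler x0 T b sigma W Gh1 Gh2 N Xh ->
  (forall x, 0 < x -> x <= T -> frob_norm (G1 x) ^+ 2 <= Q x) ->
  (forall x, 0 < x -> x <= T -> frob_norm (G2 x) ^+ 2 <= Q x) ->
  0 <= B ->
  (forall k, (k <= N)%N -> mean_le P (fun w => euclid_norm (Xh k w) ^+ 2) B) ->
  0 <= theta ->
  h * \sum_(1 <= l < N.+1)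
    (4 * kappa * c * Q (l%:R * h)) * expR (- theta * (l%:R * h)) <= 1 / 2 ->
  forall k, (k <= N)%N ->
  mean_le P (fun w => euclid_norm (Xh k w - X k w) ^+ 2)
    (4 * kappa * c * (1 + B) * expR (theta * T) * (h * \sum_(1 <= l < N.+1)
      (frob_norm (Gh1 (t l) - G1 (t l)) ^+ 2 +
       frob_norm (Gh2 (t l) - G2 (t l)) ^+ 2))).
Proof.
move=> hX hXh G1Q G2Q B0 XhB th0 hth k kN.
pose S := h * \sum_(1 <= l < N.+1)
      (frob_norm (Gh1 (t l) - G1 (t l)) ^+ 2 +
       frob_norm (Gh2 (t l) - G2 (t l)) ^+ 2).
have S0 : 0 <= S.
  rewrite mulr_ge0 ?(ltW h0)//; apply: sumr_ge0 => l _.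
  by rewrite addr_ge0 ?sqr_ge0.
pose A := 2 * kappa * c * (1 + B) * S.
have kc0 : 0 <= kappa * c by apply: mulr_ge0.
have A0 : 0 <= A.
  rewrite /A; apply: mulr_ge0 => //; apply: mulr_ge0; last by rewrite addr_ge0.
  by rewrite -mulrA; apply: mulr_ge0.
pose U j m := mean_le P (fun w => euclid_norm (Xh j w - X j w) ^+ 2) m.
have : U k (2 * A * expR (theta * (k%:R * h))).
  apply: (@volterra_gronwall R U (fun x => 4 * kappa * c * Q x) A h theta N) => //.
  - move=> x x0_; apply: mulr_ge0; last exact: Q0.
    by rewrite -mulrA; apply: mulr_ge0.
  - by move=> j x y; exact: mean_le_mono.
  - have -> : U 0%N A = mean_le P (fun=> 0) A.
      congr (mean_le P _ A); apply/funext => w; case: hX => -> _; case: hXh => -> _.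
      by rewrite subrr euclid_norm0 expr0n.
    by apply: mean_le_mono (mean_le_cst P (lexx _)) _.
  move=> {}k {}kN v vU.
  have aX j : (j < k.+1)%N -> adapted_mx (F (t j)) (X j).
    by move=> jk; apply: (volterra_euler_adapted hX); exact: leq_trans (ltnW jk) kN.
  have aXh j : (j < k.+1)%N -> adapted_mx (F (t j)) (Xh j).
    by move=> jk; apply: (volterra_euler_adapted hXh); exact: leq_trans (ltnW jk) kN.
  have mF j := filtration_measurable hF (t0 j).
  have sF j := filtration_sigma hF (t0 j).
  have ab j jk := adapted_drift hL (sF j) (aXh j jk).
  have as_ j jk := adapted_diffusion hL (sF j) (aXh j jk).
  have adb j (jk : (j < k.+1)%N) :
      adapted_mx (F (t j)) (fun w => b (Xh j w) - b (X j w)).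
    apply: adapted_mxB; [exact: sF|exact: ab|].
    exact: (adapted_drift hL (sF j) (aX j jk)).
  have ads j (jk : (j < k.+1)%N) :
      adapted_mx (F (t j)) (fun w => sigma (Xh j w) - sigma (X j w)).
    apply: adapted_mxB; [exact: sF|exact: as_|].
    exact: (adapted_diffusion hL (sF j) (aX j jk)).
  have Bc j : (j < k.+1)%N ->
      mean_le P (fun w => c * (1 + euclid_norm (Xh j w) ^+ 2)) (c * (1 + B)).
    move=> jk; apply: mean_leZ => //; apply: mean_leD; first exact: mean_le_cst.
    by apply: XhB; exact: leq_trans (ltnW jk) kN.
  have Dc j : (j < k.+1)%N ->
      mean_le P (fun w => c * euclid_norm (Xh j w - X j w) ^+ 2) (c * v j).
    by move=> jk; apply: mean_leZ => //; exact: vU.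
  have LcD x y : L ^+ 2 * euclid_norm (x - y) ^+ 2 <= c * euclid_norm (x - y) ^+ 2.
    by rewrite ler_wpM2r ?sqr_ge0// sqr_lipschitz_le_growth.
  have mb j (jk : (j < k.+1)%N) :
      mean_le P (fun w => euclid_norm (b (Xh j w)) ^+ 2) (c * (1 + B)).
    apply: mean_le_dom (Bc j jk) => [|w].
      exact: adapted_mx_sqr_euclid_norm (@mF j) (ab j jk).
    by rewrite sqr_ge0; exact: drift_growth hL _.
  have ms j (jk : (j < k.+1)%N) :
      mean_le P (fun w => frob_norm (sigma (Xh j w)) ^+ 2) (c * (1 + B)).
    apply: mean_le_dom (Bc j jk) => [|w].
      exact: adapted_mx_sqr_frob_norm (@mF j) (as_ j jk).
    by rewrite sqr_ge0; exact: diffusion_growth hL _.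
  have mdb j (jk : (j < k.+1)%N) :
      mean_le P (fun w => euclid_norm (b (Xh j w) - b (X j w)) ^+ 2) (c * v j).
    apply: mean_le_dom (Dc j jk) => [|w].
      exact: adapted_mx_sqr_euclid_norm (@mF j) (adb j jk).
    by rewrite sqr_ge0 /=; apply: (le_trans (sqr_lipschitz_drift hL _ _)); exact: LcD.
  have mds j (jk : (j < k.+1)%N) :
      mean_le P (fun w => frob_norm (sigma (Xh j w) - sigma (X j w)) ^+ 2) (c * v j).
    apply: mean_le_dom (Dc j jk) => [|w].
      exact: adapted_mx_sqr_frob_norm (@mF j) (ads j jk).
    by rewrite sqr_ge0 /=; apply: (le_trans (sqr_lipschitz_diffusion hL _ _)); exact: LcD.
  have V1 := volterra_sum_sqr_mean_le hF hW h0 t0 tS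
    (fun j => (Gh1 \- G1) (t (k.+1 - j)%N)) (fun j => (Gh2 \- G2) (t (k.+1 - j)%N))
    ab as_ mb ms (Nh kN).
  have V2 := volterra_sum_majorized G1Q G2Q kN adb ads mdb mds.
  have mD : measurable_fun setT (fun w => euclid_norm (Xh k.+1 w - X k.+1 w) ^+ 2).
    apply: (adapted_mx_sqr_euclid_norm (@mF k.+1)); apply: adapted_mxB => //.
      exact: (volterra_euler_adapted hXh).
    exact: (volterra_euler_adapted hX).
  rewrite /U; apply: mean_le_mono.
    apply: mean_le_dom (mean_leD (mean_leZ (ler0n R 2) V1) (mean_leZ (ler0n R 2) V2)) => // w.
    rewrite sqr_ge0 (volterra_euler_step hXh kN) (volterra_euler_step hX kN) /=.
    rewrite opprD addrACA subrr add0r volterra_sum_sub.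
    exact: sqr_euclid_normD_le.
  rewrite -mulr_suml (sum_rev (fun l => frob_norm (Gh1 (t l) - G1 (t l)) ^+ 2 +
       frob_norm (Gh2 (t l) - G2 (t l)) ^+ 2)).
  have -> : \sum_(0 <= j < k.+1) Q (t (k.+1 - j)%N) * (c * v j) =
      c * \sum_(0 <= j < k.+1) Q (t (k.+1 - j)%N) * v j.
    by rewrite mulr_sumr; apply: eq_bigr => j _ /=; ring.
  have -> : \sum_(0 <= j < k.+1) 4 * kappa * c * Q ((k.+1 - j)%:R * h) * v j =
      4 * kappa * c * \sum_(0 <= j < k.+1) Q (t (k.+1 - j)%N) * v j.
    by rewrite mulr_sumr; apply: eq_bigr => j _; rewrite /t gridE mulrA.
  have SS : h * \sum_(1 <= l < k.+2)
      (frob_norm (Gh1 (t l) - G1 (t l)) ^+ 2 +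
       frob_norm (Gh2 (t l) - G2 (t l)) ^+ 2) <= S.
    rewrite ler_wpM2l ?(ltW h0)//.
    apply: (sum_widen (f := fun l => frob_norm (Gh1 (t l) - G1 (t l)) ^+ 2 +
       frob_norm (Gh2 (t l) - G2 (t l)) ^+ 2)) => // l _.
    by rewrite addr_ge0 ?sqr_ge0.
  have kcB : 0 <= kappa * c * (1 + B) by apply: mulr_ge0 => //; rewrite addr_ge0.
  have := ler_wpM2l kcB SS; rewrite -/kappa /A.
  move: (\sum_(1 <= l < k.+2) _) (\sum_(0 <= j < k.+1) _) => s1 s2; lra.
move=> h1; apply: mean_le_mono h1 _.
have -> : 4 * kappa * c * (1 + B) * expR (theta * T) * S =
    2 * A * expR (theta * T) by rewrite /A; ring.
by apply: ler_wpM2l; [rewrite mulr_ge0|rewrite ler_expR; apply: ler_wpM2l => //; exact: Nh].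
Qed.

End EulerSchemes.

(** * Stability of the scheme under perturbation of the kernels *)
Theorem theorem4p1 (R : realType) (d : nat) (hd : (0 < d)%N)
    (x0 : 'cV[R]_d)
    (b : 'cV[R]_d -> 'cV[R]_d) (sigma : 'cV[R]_d -> 'M[R]_d)
    (hlip : lipschitz_coefs b sigma)
    (lambda : {measure set (measurableTypeR R) -> \bar R}) (hlambda : admissible_measure lambda)
    (M1 M2 : R -> 'M[R]_d)
    (hM1 : bounded_measurable_mx M1) (hM2 : bounded_measurable_mx M2)
    (T : R) (hT : 0 < T) (Cbar : R) (hCbar : 0 < Cbar) :
  let G1 := laplace_kernel lambda M1 in
  let G2 := laplace_kernel lambda M2 in
  exists C : R, 0 < C /\
    forall (disp : measure_display) (Omega : measurableType disp)
      (P : probability Omega R) (F : R -> set (set Omega))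
      (W : R -> Omega -> 'cV[R]_d),
      filtration F -> brownian_motion P F W ->
    forall Gh1 Gh2 : R -> 'M[R]_d,
      measurable_mx `]0, T] Gh1 -> measurable_mx `]0, T] Gh2 ->
      (forall t : R, 0 < t -> t <= T ->
        frob_norm (Gh1 t) ^+ 2 <= Cbar * (1 + frob_norm (G1 t) ^+ 2)) ->
      (forall t : R, 0 < t -> t <= T ->
        frob_norm (Gh2 t) ^+ 2 <= Cbar * (1 + frob_norm (G2 t) ^+ 2)) ->
    forall N : nat, (0 < N)%N ->
    forall X Xh : nat -> Omega -> 'cV[R]_d,
      volterra_euler x0 T b sigma W G1 G2 N X ->
      volterra_euler x0 T b sigma W Gh1 Gh2 N Xh ->
      (\big[maxe/-oo]_(k < N.+1)
          'E_P[(fun w => euclid_norm (Xh k w - X k w) ^+ 2)%R]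
        <= (C * (T / N%:R) *
            \sum_(1 <= k < N.+1)
              (frob_norm (Gh1 (grid T N k) - G1 (grid T N k)) ^+ 2
               + frob_norm (Gh2 (grid T N k) - G2 (grid T N k)) ^+ 2))%:E)%E.

Proof.
move=> G1 G2.
have [L [L0 hL]] := hlip.
have [mM1 [K1 hK1]] := hM1; have [mM2 [K2 hK2]] := hM2.
(* Cbar (1 + a g) and a g are both at most c0 (1 + g), with g = gbar ^ 2, so
   the given kernels and their approximations share the majorant Q *)
pose a := (d%:R * K1) ^+ 2 + (d%:R * K2) ^+ 2.
have a0 : 0 <= a by rewrite addr_ge0 ?sqr_ge0.
pose c0 := (Cbar + 1) * (1 + a).
have c00 : 0 <= c0.
  by apply: mulr_ge0; apply: addr_ge0 => //; exact: ltW.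
pose Q := kernel_majorant lambda c0.
have Gle (G Gh : R -> 'M[R]_d) :
    (forall t, 0 < t -> frob_norm (G t) ^+ 2 <= a * gbar lambda t ^+ 2) ->
    (forall t, 0 < t -> t <= T ->
      frob_norm (Gh t) ^+ 2 <= Cbar * (1 + frob_norm (G t) ^+ 2)) ->
    (forall t, 0 < t -> t <= T -> frob_norm (G t) ^+ 2 <= Q t) /\
    (forall t, 0 < t -> t <= T -> frob_norm (Gh t) ^+ 2 <= Q t).
  move=> hG hGh; split=> t t0 tT; rewrite /Q /kernel_majorant /c0.
    apply: le_trans (hG t t0) _; have := sqr_ge0 (gbar lambda t).
    by move: (gbar _ _ ^+ 2) => g g0; have := mulr_ge0 a0 g0;
      have := ltW hCbar; nra.
  apply: le_trans (hGh t t0 tT) _; have := hG t t0; have := sqr_ge0 (gbar lambda t).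
  by move: (gbar _ _ ^+ 2) (frob_norm _ ^+ 2) => g f g0 fg;
    have := mulr_ge0 a0 g0; have := ltW hCbar; nra.
have G1a t : 0 < t -> frob_norm (G1 t) ^+ 2 <= a * gbar lambda t ^+ 2.
  move=> t0; apply: le_trans (sqr_frob_laplace_kernel_le hlambda mM1 hK1 t0) _.
  by rewrite ler_wpM2r ?sqr_ge0// lerDl sqr_ge0.
have G2a t : 0 < t -> frob_norm (G2 t) ^+ 2 <= a * gbar lambda t ^+ 2.
  move=> t0; apply: le_trans (sqr_frob_laplace_kernel_le hlambda mM2 hK2 t0) _.
  by rewrite ler_wpM2r ?sqr_ge0// lerDr sqr_ge0.
have Q0 x : 0 < x -> 0 <= Q x by move=> _; exact: kernel_majorant_ge0.
have Qd : nonincr_on_pos Q by exact: kernel_majorant_nonincr.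
have QT : (\int[lebesgue_measure]_(t in `]0%R, T]) (Q t)%:E < +oo)%E.
  exact: kernel_majorant_integral_lty.
pose I := fine (\int[lebesgue_measure]_(t in `]0%R, T]) (Q t)%:E)%E.
pose kappa := 2 * (T + 8 * d%:R ^+ 3).
pose c := growth_cst b sigma L.
have kc0 : 0 <= 4 * kappa * c.
  apply: mulr_ge0; last exact: growth_cst_ge0.
  apply: mulr_ge0 => //; apply: mulr_ge0 => //; apply: addr_ge0; first exact: ltW.
  by apply: mulr_ge0 => //; exact: exprn_ge0.
have [n hn] : exists n : nat, forall N : nat, (0 < N)%N ->
    T / N%:R * \sum_(1 <= l < N.+1) (4 * kappa * c * Q (l%:R * (T / N%:R))) *
      expR (- n%:R * (l%:R * (T / N%:R))) <= 1 / 2.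
  apply: (@exponential_weight_small _ (fun x => 4 * kappa * c * Q x)) => //.
  - by move=> x y x0' xy; rewrite ler_wpM2l// Qd.
  - by move=> x x0'; rewrite mulr_ge0// Q0.
  - under eq_integral do rewrite EFinM.
    rewrite ge0_integralZl//.
    + by apply: lte_mul_pinfty => //; exact: QT.
    + by apply/measurable_EFinP; exact: nonincr_on_pos_measurable.
    + by move=> x; rewrite /= in_itv/= => /andP[x0' _]; rewrite lee_fin Q0.
(* B is uniform in N: the exponential weight n and the integral I of Q do not
   depend on N *)
pose B := 2 * (2 * euclid_norm x0 ^+ 2 + 4 * kappa * c * I) * expR (n%:R * T).
(* the summand 1 only makes the constant visibly positive *)
exists (4 * kappa * c * (1 + B) * expR (n%:R * T) + 1).
have QI0 : (0 <= \int[lebesgue_measure]_(t in `]0%R, T]) (Q t)%:E)%E.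
  apply: integral_ge0 => x; rewrite /= in_itv/= => /andP[x0' _].
  by rewrite lee_fin Q0.
have B0 : 0 <= B.
  apply: mulr_ge0; last exact: expR_ge0.
  apply: mulr_ge0 => //; apply: addr_ge0; first by rewrite mulr_ge0 ?sqr_ge0.
  by apply: mulr_ge0 => //; exact: fine_ge0.
have C0 : 0 <= 4 * kappa * c * (1 + B) * expR (n%:R * T).
  by apply: mulr_ge0; [apply: mulr_ge0 => //; exact: addr_ge0|exact: expR_ge0].
split; first by rewrite ltr_wpDl.
move=> disp Omega P F W hF hW Gh1 Gh2 _ _ hGh1 hGh2 N N0 X Xh hX hXh.
have [G1Q Gh1Q] := Gle _ _ G1a hGh1.
have [G2Q Gh2Q] := Gle _ _ G2a hGh2.
have QI : T / N%:R * \sum_(1 <= l < N.+1) Q (grid T N l) <= I.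
  have h0 : 0 < T / N%:R by rewrite divr_gt0// ltr0n.
  have := riemann_sum_le_integral N h0 Qd Q0.
  have -> : N%:R * (T / N%:R) = T by rewrite mulrC divfK// pnatr_eq0 -lt0n.
  rewrite -[leRHS]fineK; last by rewrite ge0_fin_numE.
  rewrite lee_fin => h; apply: le_trans h; rewrite le_eqVlt; apply/orP; left.
  by apply/eqP; congr (_ * _); apply: eq_bigr => l _; rewrite gridE.
have XhB k : (k <= N)%N -> mean_le P (fun w => euclid_norm (Xh k w) ^+ 2) B.
  exact: (volterra_euler_moment hL hF hW hT N0 Q0 hXh Gh1Q Gh2Q QI (ler0n _ n) (hn N N0)).
have err := volterra_euler_error hL hF hW hT N0 Q0 hX hXh G1Q G2Q B0 XhB
  (ler0n _ n) (hn N N0).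
apply: bigmax_le => [|k _]; first exact: leNye.
have [_ _] := err k (ltn_ord k); rewrite expectation.unlock => hk; apply: le_trans hk _.
rewrite lee_fin -[leRHS]mulrA ler_wpM2r ?lerDl//.
rewrite mulr_ge0 ?divr_ge0 ?(ltW hT)//; apply: sumr_ge0 => l _.
by rewrite addr_ge0 ?sqr_ge0.
Qed.
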